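(* Let $n\ge2$, $\varepsilon\in(0,1)$, $\delta\in(0,1)$, and let $c,C>0$ be universal constants such that for all distributions $\mathcal{D}_1,\mathcal{D}_2$ on $[n]$ with $d=\mathrm{TV}(\mathcal{D}_1,\mathcal{D}_2)>\varepsilon$ and all $k\ge1$, $\mathbb{E}[Z_k]\ge C\min\{kd,k^2d^2/n,k^{3/2}d^2/\sqrt n\}-c\sqrt k$. Let $\Delta_t=C\min\{t\varepsilon,t^2\varepsilon^2/n,t^{3/2}\varepsilon^2/\sqrt n\}-c\sqrt t$ and $\Psi_t=2\sqrt{2t\log(\pi^2/(3\delta))+4et\log(\log(4t)+1)}$. Algorithm 4 computes $Z_t$ for $t=1,2,\dots$, stops and outputs $2$ at $\tau_2=\inf\{t\ge1:|Z_t|>\Psi_t\}$ and stops and outputs $1$ at $\tau_1=\inf\{t\ge1:|Z_t|\le\Delta_t-\Psi_t\}$ (whichever comes first). For $\eta>0$ let $$N_\eta=\max\Bigg\{\frac{128}{C^2}\frac{\log(\frac{\pi^2}{3\delta})}{\eta^2}+\frac{512e}{C^2\eta^2}\log\left(\log\left(\frac{128\log(\frac{\pi^2}{3\delta})}{\eta^2C^2}\right)+1\right)+\frac{16c^2}{C^2\eta^2},$$ $$\left(\frac{128}{C^2}\frac{n^2\log(\frac{\pi^2}{3\delta})}{\eta^4}+\frac{512en^2}{C^2\eta^4}\log\left(\log\left(\frac{128}{C^2}\frac{n^2\log(\frac{\pi^2}{3\delta})}{\eta^4}\right)+1\right)+\frac{16c^2n^2}{\eta^4C^2}\right)^{1/3},$$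 $$\left(\frac{128}{C^2}\frac{n\log(\frac{\pi^2}{3\delta})}{\eta^4}+\frac{512en}{C^2\eta^4}\log\left(\log\left(\frac{128}{C^2}\frac{n\log(\frac{\pi^2}{3\delta})}{\eta^4}\right)+1\right)+\frac{16c^2n}{\eta^4C^2}\right)^{1/2}\Bigg\}.$$ Then, with $d=\mathrm{TV}(\mathcal{D}_1,\mathcal{D}_2)$: if $\mathcal{D}_1=\mathcal{D}_2$, $\mathbb{E}(\tau_1)\le2N_\varepsilon$; if $d>\varepsilon$, $\mathbb{E}(\tau_2)\le2N_d$.
   Context: $[n]=\{1,\dots,n\}$, $\mathrm{TV}(\mathcal{D},\mathcal{D}')=\frac12\sum_i|\mathcal{D}_i-\mathcal{D}'_i|$. Definition of $Z_t$: let $(A_j),(A'_j)$ be i.i.d. sequences from $\mathcal{D}_1$ and $(B_j),(B'_j)$ i.i.d. from $\mathcal{D}_2$, all independent; for each $t\ge1$, independently of the samples, draw $(m_{1,t},m'_{1,t},m_{2,t},m'_{2,t})\sim\mathrm{Multinom}(4t,(1/4,1/4,1/4,1/4))$; for $i\in[n]$ let $X_i,X'_i,Y_i,Y'_i$ count occurrences of $i$ among $A_1,\dots,A_{m_{1,t}}$, $A'_1,\dots,A'_{m'_{1,t}}$, $B_1,\dots,B_{m_{2,t}}$, $B'_1,\dots,B'_{m'_{2,t}}$; $Z_t=\sum_{i=1}^n(|X_i-Y_i|+|X'_i-Y'_i|-|X_i-X'_i|-|Y_i-Y'_i|)$. *)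

(* Defs.v *)
From HB Require Import structures.
From mathcomp Require Export all_boot all_order all_algebra.
From mathcomp Require Export finmap.
From mathcomp Require Export all_classical all_reals all_analysis.
Set Implicit Arguments.
Unset Strict Implicit.
Unset Printing Implicit Defensive.
Import Order.TTheory GRing.Theory Num.Theory.
Import numFieldNormedType.Exports.
Local Open Scope classical_set_scope.
Local Open Scope ring_scope.

(* The set {1, ..., n} is represented by 'I_n = {0, ..., n-1}. *)
Definition is_distr (R : realType) (n : nat) (D : {ffun 'I_n -> R}) : Prop :=
  (forall i, 0 <= D i) /\ \sum_(i < n) D i = 1.

Definition TV (R : realType) (n : nat) (D D' : {ffun 'I_n -> R}) : R :=
  2^-1 * \sum_(i < n) `|D i - D' i|.

(* The four sample streams are indexed by (b, b') : bool * bool: b = false for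
   samples from D1 and b = true for samples from D2; b' tells whether the
   stream is primed. Hence A = (false, false), A' = (false, true),
   B = (true, false), B' = (true, true). *)
Definition stream : Type := (bool * bool)%type.
Definition sA : stream := (false, false).
Definition sA' : stream := (false, true).
Definition sB : stream := (true, false).
Definition sB' : stream := (true, true).

Definition stream_distr (R : realType) (n : nat) (D1 D2 : {ffun 'I_n -> R})
  (g : stream) : {ffun 'I_n -> R} := if g.1 then D2 else D1.

Definition multinomial_pmf (R : realType) (K : finType) (N : nat) (p : K -> R)
    (v : {ffun K -> nat}) : R :=
  if (\sum_g v g == N)%N then
    (N`!)%:R / (\prod_g ((v g)`!)%:R) * \prod_g p g ^+ v g
  else 0.

(* Mutual independence of a family of random variables with values in a
   countable type carrying the discrete sigma-algebra: the product rule over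
   every finite subfamily. *)
Definition mutually_independent (R : realType) (d : measure_display)
    (T : measurableType d) (P : probability T R) (I : choiceType) (V : Type)
    (X : I -> T -> V) : Prop :=
  forall (J : {fset I}) (E : I -> set V),
    P (\bigcap_(i in [set` J]) (X i @^-1` E i)) =
    (\prod_(i <- J) P (X i @^-1` E i))%E.

(* Y is independent of the whole family X, for discrete-valued variables: the
   events of Y are independent of the pi-system generating sigma(X). *)
Definition independent_of_family (R : realType) (d : measure_display)
    (T : measurableType d) (P : probability T R) (I : choiceType) (V W : Type)
    (Y : T -> W) (X : I -> T -> V) : Prop :=
  forall (F : set W) (J : {fset I}) (E : I -> set V),
    P (Y @^-1` F `&` \bigcap_(i in [set` J]) (X i @^-1` E i)) =
    (P (Y @^-1` F) * P (\bigcap_(i in [set` J]) (X i @^-1` E i)))%E.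

(* S g j is the (j+1)-st sample of the stream g. *)
Definition sample_streams (R : realType) (n : nat) (D1 D2 : {ffun 'I_n -> R})
    (d : measure_display) (T : measurableType d) (P : probability T R)
    (S : stream -> nat -> T -> 'I_n) : Prop :=
  [/\ forall g j i, measurable (S g j @^-1` [set i]),
      forall g j i, P (S g j @^-1` [set i]) = (stream_distr D1 D2 g i)%:E
    & mutually_independent P (fun gj : stream * nat => S gj.1 gj.2)].

(* m = (m_{1,t}, m'_{1,t}, m_{2,t}, m'_{2,t}), indexed by stream. *)
Definition sample_counts (R : realType) (n : nat) (d : measure_display)
    (T : measurableType d) (P : probability T R)
    (S : stream -> nat -> T -> 'I_n) (t : nat) (m : T -> {ffun stream -> nat})
    : Prop :=
  [/\ forall v, measurable (m @^-1` [set v]),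
      forall v, P (m @^-1` [set v]) =
        (multinomial_pmf (4 * t)%N (fun _ : stream => 4^-1 : R) v)%:E
    & independent_of_family P m (fun gj : stream * nat => S gj.1 gj.2)].

Definition Zstat (R : realType) (n : nat) (xs : stream -> seq 'I_n) : R :=
  let N g i : R := (count_mem i (xs g))%:R in
  \sum_(i < n) (`|N sA i - N sB i| + `|N sA' i - N sB' i|
                - `|N sA i - N sA' i| - `|N sB i - N sB' i|).

Definition Zrv (R : realType) (n : nat) (d : measure_display)
    (T : measurableType d) (S : stream -> nat -> T -> 'I_n)
    (m : T -> {ffun stream -> nat}) (w : T) : R :=
  Zstat R (fun g => mkseq (fun j => S g j w) (m w g)).

Definition mean_lower_bound (R : realType) (c C : R) (n : nat) (x : R)
    (t : nat) : R :=
  C * Num.min (t%:R * x)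
        (Num.min (t%:R ^+ 2 * x ^+ 2 / n%:R)
                 (t%:R `^ (3 / 2) * x ^+ 2 / Num.sqrt n%:R))
  - c * Num.sqrt t%:R.

Definition log_term (R : realType) (delta : R) : R :=
  ln (pi ^+ 2 / (3 * delta)).

Definition Psi (R : realType) (delta : R) (t : nat) : R :=
  2 * Num.sqrt (2 * t%:R * log_term delta
                + 4 * expR 1 * t%:R * ln (ln (4 * t%:R) + 1)).

(* inf {t >= 1 : E t}, equal to +oo when no such t exists. *)
Definition first_time (R : realType) (E : nat -> Prop) : \bar R :=
  ereal_inf [set (t%:R)%:E | t in [set t | (1 <= t)%N /\ E t]].

Definition tau1 (R : realType) (c C : R) (n : nat) (eps delta : R) (T : Type)
    (Z : nat -> T -> R) (w : T) : \bar R :=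
  first_time R (fun t =>
    `|Z t w| <= mean_lower_bound c C n eps t - Psi delta t).

Definition tau2 (R : realType) (delta : R) (T : Type) (Z : nat -> T -> R)
    (w : T) : \bar R :=
  first_time R (fun t => Psi delta t < `|Z t w|).

(* The three quantities inside the maximum defining N_eta have the same shape,
   with k = 1 / eta^2, n^2 / eta^4 and n / eta^4 respectively. *)
Definition N_radicand (R : realType) (c C delta k : R) : R :=
  128 / C ^+ 2 * (k * log_term delta)
  + 512 * expR 1 * k / C ^+ 2
    * ln (ln (128 / C ^+ 2 * (k * log_term delta)) + 1)
  + 16 * c ^+ 2 * k / C ^+ 2.

Definition N_bound (R : realType) (c C : R) (n : nat) (delta eta : R) : R :=
  Num.max (N_radicand c C delta (1 / eta ^+ 2))
    (Num.max (N_radicand c C delta (n%:R ^+ 2 / eta ^+ 4) `^ (1 / 3))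
             (N_radicand c C delta (n%:R / eta ^+ 4) `^ (1 / 2))).

(* Main.v *)
(* The counts and samples used at time t are distributed as 4t independent
   letters (g, i), with g uniform among the four streams and i drawn from the
   distribution of g, dealt to their streams. Inserting a letter changes Z_t by
   at most 2, so Z_t has sub-Gaussian tails:
   P(|Z_t - E Z_t| >= u) <= 2 exp(-u^2 / (80 t)) for u <= 2t. Exchanging A' and B
   shows that E Z_t = 0 when D1 = D2. Let mu_t be the C min{...} part of the lower
   bound on the mean. For t >= N_eta, c sqrt t and Psi_t are each at most mu_t / 4,
   hence failing to stop at t forces a deviation of at least mu_t / 2, which has
   probability at most 2 exp(-3t / N_eta). Summing this geometric tail gives 2 N_eta.
   The constants need C <= 4, which follows from the assumed lower bound applied
   to two distinct point masses. *)
Require Import Defs.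
From mathcomp Require Import all_boot all_order all_algebra.
From mathcomp Require Import finmap.
From mathcomp Require Import all_classical all_reals all_analysis.
From mathcomp Require Import ring lra.
Set Implicit Arguments.
Unset Strict Implicit.
Unset Printing Implicit Defensive.
Import Order.TTheory GRing.Theory Num.Theory.
Import numFieldNormedType.Exports.
Local Open Scope classical_set_scope.
Local Open Scope ring_scope.

(** * Means over random words *)

Section WordMean.
Variables (R : realType) (X : finType) (p : X -> R).

(** For a probability vector [p], the expectation of [h] on a word of [N] i.i.d. letters. Peeling
    off the first letter turns its properties into inductions on [N], with no product measure. *)
Fixpoint wmean (N : nat) (h : seq X -> R) : R :=
  if N is N'.+1 then \sum_x p x * wmean N' (fun s => h (x :: s)) else h [::].

Lemma eq_wmean N h1 h2 : (forall s, size s = N -> h1 s = h2 s) ->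
  wmean N h1 = wmean N h2.
Proof.
elim: N h1 h2 => [|N IH] h1 h2 h12 /=; first exact: h12.
by apply: eq_bigr => x _; congr (_ * _); apply: IH => s sN; apply: h12; rewrite /= sN.
Qed.

Lemma wmeanD N h1 h2 : wmean N (fun s => h1 s + h2 s) = wmean N h1 + wmean N h2.
Proof.
elim: N h1 h2 => [//|N IH] h1 h2 /=.
by rewrite -big_split /=; apply: eq_bigr => x _; rewrite IH mulrDr.
Qed.

Lemma wmeanZ N a h : wmean N (fun s => a * h s) = a * wmean N h.
Proof.
elim: N h => [//|N IH] h /=.
by rewrite mulr_sumr; apply: eq_bigr => x _; rewrite IH mulrCA.
Qed.

Lemma wmean_sum N (I : Type) (r : seq I) (h : I -> seq X -> R) :
  wmean N (fun s => \sum_(i <- r) h i s) = \sum_(i <- r) wmean N (h i).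
Proof.
elim: r => [|i r IH].
  under eq_wmean => s _ do rewrite big_nil -[0](mul0r 0).
  by rewrite wmeanZ mul0r big_nil.
by under eq_wmean => s _ do rewrite big_cons; rewrite wmeanD IH big_cons.
Qed.

Lemma wmean_map N (f : X -> X) h : involutive f -> (forall x, p (f x) = p x) ->
  wmean N (fun s => h (map f s)) = wmean N h.
Proof.
move=> fK pf; elim: N h => [//|N IH] h /=.
rewrite (reindex_inj (inv_inj fK)); apply: eq_bigr => x _ /=.
by rewrite pf fK (IH (fun s => h (x :: s))).
Qed.

Hypothesis p0 : forall x, 0 <= p x.

Lemma ler_wmean N h1 h2 : (forall s, size s = N -> h1 s <= h2 s) ->
  wmean N h1 <= wmean N h2.
Proof.
elim: N h1 h2 => [|N IH] h1 h2 h12 /=; first exact: h12.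
apply: ler_sum => x _; apply: ler_wpM2l => //.
by apply: IH => s sN; apply: h12; rewrite /= sN.
Qed.

Hypothesis p1 : \sum_x p x = 1.

Lemma wmean_cst N a : wmean N (fun=> a) = a.
Proof. by elim: N => [//|N /= ->]; rewrite -mulr_suml p1 mul1r. Qed.

Lemma wmean_dist N h1 h2 b : (forall s, `|h1 s - h2 s| <= b) ->
  `|wmean N h1 - wmean N h2| <= b.
Proof.
move=> hb; rewrite -mulN1r -wmeanZ -wmeanD ler_norml.
apply/andP; split; [rewrite -[leLHS](wmean_cst N)|rewrite -[leRHS](wmean_cst N)];
  by apply: ler_wmean => s _; have := hb s; rewrite mulN1r ler_norml => /andP[].
Qed.

(** Since [expR (- x) >= 1 - x], the exponential is at most [1 / (1 - x)]. Multiplying the quadratic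
    by [1 - x] leaves the excess [x^2 (1/4 - 5/4 x)], nonnegative for [x <= 1/5]. *)
Lemma expR_le_quadratic (x : R) : x <= 1/5 -> expR x <= 1 + x + 5/4 * x ^+ 2.
Proof.
move=> x5; have := expR_ge1Dx (- x); rewrite expRN => e.
have e0 := expR_gt0 x.
have {e} : (1 - x) * expR x <= 1.
  by rewrite -ler_pdivlMr ?expR_gt0// div1r.
have d : 0 <= (1 + x + 5/4 * x ^+ 2) * (1 - x) - 1.
  have -> : (1 + x + 5/4 * x ^+ 2) * (1 - x) - 1 = x ^+ 2 * (1/4 - 5/4 * x) by field.
  by apply: mulr_ge0; [exact: sqr_ge0|lra].
have x1 : 0 < 1 - x by lra.
by move=> e; rewrite -(ler_pM2r x1); lra.
Qed.

(* The centre [a0] bounds the variance by [b ^ 2], although [a] itself only has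
   oscillation [2 b]. *)
Lemma mean_expR_le (a : X -> R) (a0 b l : R) :
  (forall x, `|a x - a0| <= b) -> `|l| * (2 * b) <= 1/5 ->
  \sum_x p x * expR (l * a x) <=
  expR (l * (\sum_x p x * a x) + 5/4 * b ^+ 2 * l ^+ 2).
Proof.
move=> ab lb; set m := \sum_x p x * a x.
have mE (f : R -> R) : \sum_x p x * (f m) = f m by rewrite -mulr_suml p1 mul1r.
have m0 : `|m - a0| <= b.
  rewrite -(mE (fun y => y - a0)) /m.
  have -> : \sum_x p x * (m - a0) = \sum_x p x * (a x - a0).
    under eq_bigr do rewrite mulrBr; under [RHS]eq_bigr do rewrite mulrBr.
    by rewrite !sumrB -mulr_suml p1 mul1r.
  apply: (le_trans (ler_norm_sum _ _ _)).
  rewrite -[leRHS]mul1r -p1 mulr_suml; apply: ler_sum => x _.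
  by rewrite normrM ger0_norm//; apply: ler_wpM2l.
have var : \sum_x p x * (a x - m) ^+ 2 <= b ^+ 2.
  have -> : \sum_x p x * (a x - m) ^+ 2 =
    \sum_x p x * (a x - a0) ^+ 2 - (m - a0) ^+ 2.
    rewrite -(mE (fun y => (y - a0) ^+ 2)).
    apply/eqP; rewrite -subr_eq0 -sumrB -sumrB.
    under eq_bigr => x _.
      have -> : p x * (a x - m) ^+ 2 - (p x * (a x - a0) ^+ 2 - p x * (m - a0) ^+ 2)
        = 2 * (a0 - m) * (p x * a x) - 2 * (a0 - m) * m * p x by ring.
      over.
    by rewrite sumrB -!mulr_sumr p1 -/m mulr1 subrr.
  have h0 := sqr_ge0 (m - a0).
  suff : \sum_x p x * (a x - a0) ^+ 2 <= b ^+ 2 by lra.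
  rewrite -[leRHS]mul1r -p1 mulr_suml; apply: ler_sum => x _.
  by apply: ler_wpM2l => //; rewrite -[leLHS]real_normK ?num_real// lerXn2r ?nnegrE// (le_trans _ (ab x)).
(* The linear term of the quadratic bound averages to zero because [m] is the mean; the quadratic
   one is the variance. *)
have key : \sum_x p x * expR (l * (a x - m)) <= 1 + 5/4 * b ^+ 2 * l ^+ 2.
  have h x : p x * expR (l * (a x - m)) <=
     p x + l * (p x * a x - p x * m) + 5/4 * l ^+ 2 * (p x * (a x - m) ^+ 2).
    have -> : p x + l * (p x * a x - p x * m) + 5/4 * l ^+ 2 * (p x * (a x - m) ^+ 2)
     = p x * (1 + l * (a x - m) + 5/4 * (l * (a x - m)) ^+ 2) by ring.
    apply: ler_wpM2l => //; apply: expR_le_quadratic.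
    apply: le_trans lb; apply: (le_trans (ler_norm _)); rewrite normrM.
    apply: ler_wpM2l => //; have := ler_distD a0 (a x) m.
    by have := ab x; rewrite (distrC a0 m); lra.
  apply: (le_trans (ler_sum _ (fun x _ => h x))).
  rewrite 2!big_split /= -!mulr_sumr sumrB -/m p1 (mE id) subrr.
  by have := sqr_ge0 l; nra.
have -> : \sum_x p x * expR (l * a x) =
    expR (l * m) * \sum_x p x * expR (l * (a x - m)).
  rewrite mulr_sumr; apply: eq_bigr => x _.
  by rewrite mulrCA -expRD; congr (_ * expR _); ring.
rewrite expRD; apply: ler_wpM2l; first exact: expR_ge0.
by apply: (le_trans key); rewrite expR_ge1Dx.
Qed.

(** Condition on the first letter and use induction for the rest. The conditional means all lie
    within [b] of [wmean N h], the mean with that letter left out, which serves as the centre in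
    [mean_expR_le]. *)
Lemma wmean_expR_le (b l : R) N h :
  (forall s1 x s2, `|h (s1 ++ x :: s2) - h (s1 ++ s2)| <= b) ->
  `|l| * (2 * b) <= 1/5 ->
  wmean N (fun s => expR (l * h s)) <=
  expR (l * wmean N h + N%:R * (5/4 * b ^+ 2 * l ^+ 2)).
Proof.
move=> hb lb; elim: N h hb => [|N IH] h hb /=; first by rewrite mul0r addr0.
set c := 5/4 * b ^+ 2 * l ^+ 2 in IH *.
have hx x : wmean N (fun s => expR (l * h (x :: s))) <=
    expR (N%:R * c) * expR (l * wmean N (fun s => h (x :: s))).
  rewrite -expRD addrC; apply: IH => s1 y s2; exact: (hb (x :: s1)).
have {}hx : \sum_x p x * wmean N (fun s => expR (l * h (x :: s))) <=
    expR (N%:R * c) * \sum_x p x * expR (l * wmean N (fun s => h (x :: s))).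
  rewrite mulr_sumr; apply: ler_sum => x _.
  by rewrite mulrCA; apply: ler_wpM2l.
apply: (le_trans hx); rewrite -[N.+1]addn1 natrD mulrDl mul1r addrCA expRD.
apply: ler_wpM2l; first exact: expR_ge0.
apply: (mean_expR_le (a0 := wmean N h)) => // x.
by apply: wmean_dist => s; exact: (hb [::]).
Qed.

Lemma wmean_tail (b t : R) N (h : seq X -> R) :
  (forall s1 x s2, `|h (s1 ++ x :: s2) - h (s1 ++ s2)| <= b) ->
  0 < b -> (0 < N)%N -> 0 <= t -> t <= b * N%:R / 4 ->
  wmean N (fun s => (t <= `|h s - wmean N h|)%R%:R) <=
  2 * expR (- (t ^+ 2 / (5 * b ^+ 2 * N%:R))).
Proof.
move=> hb b0; rewrite -(ltr0n R) => N0 t0 tN; set m := wmean N h.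
have bN : b ^+ 2 * N%:R != 0 by rewrite mulf_neq0 ?expf_neq0// gt_eqF.
(* The minimiser of the Chernoff exponent [- l t + 5/4 N b^2 l^2]; the bound assumed on [t] says
   exactly that [2 b l <= 1/5]. *)
pose l := 2 * t / (5 * b ^+ 2 * N%:R).
have den0 : 0 < 5 * b ^+ 2 * N%:R by rewrite !mulr_gt0// exprn_gt0.
have l0 : 0 <= l by rewrite divr_ge0 ?mulr_ge0// ltW.
have lb : l * (2 * b) <= 1/5.
  rewrite /l mulrAC ler_pdivrMr//.
  by have := ler_wpM2l (ltW b0) tN; lra.
have tail l' : `|l'| = l ->
    wmean N (fun s => expR (- l' * m - l * t) * expR (l' * h s)) <=
    expR (- (t ^+ 2 / (5 * b ^+ 2 * N%:R))).
  move=> l'l.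
  rewrite wmeanZ; apply: (le_trans (ler_wpM2l (expR_ge0 _) (wmean_expR_le N hb _))).
    by rewrite l'l.
  rewrite -expRD ler_expR -/m -[l' ^+ 2]real_normK ?num_real// l'l /l.
  by rewrite le_eqVlt; apply/orP; left; apply/eqP; field; lra.
(* The indicator is at most the sum of the two exponentials: on the event, the one matching the sign
   of [h s - m] is at least 1. *)
apply: (@le_trans _ _ (wmean N (fun s => expR (- l * m - l * t) * expR (l * h s) +
   expR (- - l * m - l * t) * expR (- l * h s)))).
  apply: ler_wmean => s _; rewrite -!expRD.
  case: (boolP (t <= _)) => [|_]; last by rewrite addr_ge0// expR_ge0.
  have e1 (x : R) : 0 <= x -> 1 <= expR x by move=> x0; rewrite -expR0 ler_expR.
  clear tail; clearbody l m; move=> th; have [hs|hs] := leP 0 (h s - m).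
    rewrite (ger0_norm hs) in th.
    apply: ler_wpDr; first exact: expR_ge0.
    by apply: e1; have := ler_wpM2l l0 th; lra.
  rewrite (ltr0_norm hs) in th.
  apply: ler_wpDl; first exact: expR_ge0.
  by apply: e1; have := ler_wpM2l l0 th; lra.
rewrite wmeanD; apply: (le_trans (lerD (tail l _) (tail (- l) _))); last lra.
  by rewrite ger0_norm.
by rewrite normrN ger0_norm.
Qed.

End WordMean.

(** * Dealing a word to the streams *)

Section Deal.
Variables (K I : finType).

Definition deal (s : seq (K * I)) : {ffun K -> seq I} :=
  [ffun g => [seq x.2 | x <- s & x.1 == g]].

Lemma deal_cons x s g :
  deal (x :: s) g = if x.1 == g then x.2 :: deal s g else deal s g.
Proof. by rewrite !ffunE /=; case: ifP. Qed.

Definition behead_at (g : K) (ws : {ffun K -> seq I}) : {ffun K -> seq I} :=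
  [ffun k => if k == g then behead (ws k) else ws k].

(** Factors the event by the first letter, so that the law of a dealt word can be computed by
    induction. *)
Lemma deal_cons_eq x s ws : (deal (x :: s) == ws) =
  (ohead (ws x.1) == Some x.2) && (deal s == behead_at x.1 ws).
Proof.
apply/eqP/andP => [<-|[/eqP h /eqP e]].
  rewrite deal_cons eqxx eqxx; split=> //.
  apply/eqP; apply/ffunP => k; rewrite [RHS]ffunE deal_cons.
  by rewrite (eq_sym k); case: (x.1 == k).
apply/ffunP => k; rewrite deal_cons e ffunE (eq_sym k).
case: eqP => [<-|//]; move: h.
by case: (ws x.1) => //= y t [<-].
Qed.

Variables (R : realType) (q : K -> R) (D : K -> I -> R).

(* Removing the first letter of the word: [multinomial_pmf] at [ws] is the sum
   over [g] of the fraction [size (ws g) / N.+1] of itself. *)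
Lemma wmean_deal N (ws : {ffun K -> seq I}) :
  wmean (fun x => q x.1 * D x.1 x.2) N (fun s => (deal s == ws)%:R) =
  multinomial_pmf N q [ffun g => size (ws g)] *
  \prod_g \prod_(i <- ws g) D g i.
Proof.
elim: N ws => [|N IH] ws /=.
  rewrite /multinomial_pmf.
  have -> : (deal [::] == ws) = ((\sum_g [ffun g => size (ws g)] g)%N == 0%N).
    apply/eqP/idP => [<-|].
      by rewrite sum_nat_eq0; apply/forallP => g; rewrite !ffunE.
    rewrite sum_nat_eq0 => /forallP h; apply/ffunP => g.
    by have := h g; rewrite !ffunE /= => /nilP ->.
  case: eqP => [/eqP|_]; last by rewrite mul0r.
  rewrite sum_nat_eq0 => /forallP h.
  have w0 g : ws g = [::] by have := h g; rewrite ffunE => /nilP.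
  rewrite !big1 ?divr1 ?mul1r// => g _; rewrite ?ffunE w0 ?big_nil//.
pose Wd := \prod_g (size (ws g))`!%:R : R.
pose B := \prod_g q g ^+ size (ws g) * \prod_g \prod_(i <- ws g) D g i.
have Wd0 : Wd != 0.
  by apply/prodf_neq0 => g _; rewrite pnatr_eq0 -lt0n fact_gt0.
transitivity (\sum_g (if (\sum_g size (ws g) == N.+1)%N
    then N`!%:R * (size (ws g))%:R / Wd * B else 0)).
  transitivity (\sum_g \sum_i q g * D g i *
      wmean (fun x => q x.1 * D x.1 x.2) N (fun s => (deal ((g, i) :: s) == ws)%:R)).
    by rewrite pair_bigA; apply: eq_bigr => -[].
  apply: eq_bigr => g _.
  transitivity (\sum_i q g * D g i * ((ohead (ws g) == Some i)%:R *
      (multinomial_pmf N q [ffun k => size (behead_at g ws k)] *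
       \prod_k \prod_(j <- behead_at g ws k) D k j))).
    apply: eq_bigr => i _; congr (_ * _); rewrite -IH -wmeanZ.
    by apply: eq_wmean => s _; rewrite deal_cons_eq -mulnb natrM.
  (* An empty stream cannot have received the first letter, which matches its fraction
     [size (ws g) / N.+1] being 0. *)
  case E: (ws g) => [|i0 t] /=.
    rewrite big1 => [|i _]; last by rewrite mul0r mulr0.
    by rewrite mulr0 mul0r mul0r if_same.
  rewrite (bigD1 i0)//= [X in _ + X]big1 ?addr0; last first.
    move=> i ii0; case: eqP => [[e]|_]; last by rewrite mul0r mulr0.
    by rewrite e eqxx in ii0.
  rewrite eqxx mul1r /multinomial_pmf.
  have bE k : behead_at g ws k = if k == g then t else ws k.
    by rewrite ffunE; case: eqP => [->|//]; rewrite E.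
  have -> : ((\sum_k [ffun k => size (behead_at g ws k)] k)%N == N) =
            ((\sum_k size (ws k))%N == N.+1).
    rewrite (bigD1 g)//= [in RHS](bigD1 g)//= !ffunE eqxx E /= addSn eqSS.
    by under eq_bigr => k /negPf kg do rewrite ffunE bE kg.
  case: ifP => _; last by rewrite mul0r mulr0.
  have -> : \prod_k ([ffun k => size (behead_at g ws k)] k)`!%:R = Wd / (size t).+1%:R.
    rewrite /Wd (bigD1 g)//= [in RHS](bigD1 g)//= !ffunE eqxx E /= factS natrM.
    under eq_bigr => k /negPf kg do rewrite ffunE bE kg.
    by field; rewrite addrC natr1 pnatr_eq0.
  rewrite /B.
  have -> : \prod_k q k ^+ size (ws k) =
     q g * \prod_k q k ^+ [ffun k => size (behead_at g ws k)] k.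
    rewrite (bigD1 g)//= [in RHS](bigD1 g)//= !ffunE eqxx E /= exprS -mulrA.
    by congr (_ * (_ * _)); apply: eq_bigr => k /negPf kg; rewrite ffunE bE kg.
  have -> : \prod_k \prod_(i <- ws k) D k i =
     D g i0 * \prod_k \prod_(i <- behead_at g ws k) D k i.
    rewrite (bigD1 g)//= [in RHS](bigD1 g)//= bE eqxx E big_cons -mulrA.
    by congr (_ * (_ * _)); apply: eq_bigr => k /negPf kg; rewrite bE kg.
  by field; rewrite Wd0 addrC natr1 pnatr_eq0.
rewrite /multinomial_pmf.
have vE g : [ffun g => size (ws g)] g = size (ws g) by rewrite ffunE.
rewrite (eq_bigr _ (fun g _ => vE g)).
case: ifP => [/eqP e|_]; last by rewrite big1 ?mul0r.
rewrite -!mulr_suml -mulr_sumr -natr_sum e factS natrM.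
rewrite (eq_bigr (fun g => (size (ws g))`!%:R)) => [|g _]; last by rewrite vE.
rewrite [X in _ / _ * X * _](eq_bigr (fun g => q g ^+ size (ws g))) => [|g _]; last by rewrite vE.
by rewrite /B -/Wd; field.
Qed.

Lemma deal_insert s1 x s2 :
  exists t1 t2, forall g,
   deal (s1 ++ x :: s2) g = (if x.1 == g then t1 ++ x.2 :: t2 else deal (s1 ++ s2) g)
   /\ (x.1 == g -> deal (s1 ++ s2) g = t1 ++ t2).
Proof.
exists (deal s1 x.1), (deal s2 x.1) => g; split.
  rewrite !ffunE !filter_cat !map_cat /=.
  by case: eqP => [->|].
by move=> /eqP <-; rewrite !ffunE filter_cat map_cat.
Qed.

End Deal.

(** * The statistic on dealt words: bounded differences, symmetry and size *)

Lemma normB_addn_l (R : realDomainType) (b : bool) (x y : R) :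
  `|(`|b%:R + x - y| - `|x - y|)| <= b%:R.
Proof.
apply: (le_trans (ler_dist_dist _ _)).
have -> : b%:R + x - y - (x - y) = b%:R :> R by ring.
by rewrite normr_nat.
Qed.

Lemma normB_addn_r (R : realDomainType) (b : bool) (x y : R) :
  `|(`|x - (b%:R + y)| - `|x - y|)| <= b%:R.
Proof. by rewrite (distrC x (_ + y)) (distrC x y) normB_addn_l. Qed.

Section Zstat.
Variables (R : realType) (n : nat).

(** Only the summand of the inserted value changes. Each stream occurs in exactly two of its four
    absolute values, and each of these moves by at most 1. *)
Lemma Zstat_deal_insert (s1 : seq (stream * 'I_n)) x s2 :
  `|Zstat R (deal (s1 ++ x :: s2)) - Zstat R (deal (s1 ++ s2))| <= 2.
Proof.
pose N1 g i := (count_mem i (deal (s1 ++ x :: s2) g))%:R : R.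
pose N2 g i := (count_mem i (deal (s1 ++ s2) g))%:R : R.
pose F (N : stream -> 'I_n -> R) i := `|N sA i - N sB i| + `|N sA' i - N sB' i|
  - `|N sA i - N sA' i| - `|N sB i - N sB' i|.
rewrite -[Zstat R _]/(\sum_i F N1 i) -[Zstat R (deal (s1 ++ s2))]/(\sum_i F N2 i).
rewrite -sumrB; apply: (le_trans (ler_norm_sum _ _ _)).
have -> : 2 = \sum_(i < n) 2 * (x.2 == i)%:R :> R.
  rewrite (bigD1 x.2)//= eqxx mulr1 big1 ?addr0// => i.
  by rewrite eq_sym => /negPf ->; rewrite mulr0.
apply: ler_sum => i _.
have cE g : N1 g i = ((x.1 == g) && (x.2 == i))%:R + N2 g i.
  rewrite /N1 /N2; have [t1 [t2 h]] := deal_insert s1 x s2.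
  have [-> e] := h g.
  case: eqP e => [_ ->//|_ _]; last by rewrite add0r.
  by rewrite !count_cat /= !natrD; ring.
rewrite /F !cE; case: x.1 => [[] []]; rewrite /= ?andbF ?add0r; set b := (x.2 == i).
- have := normB_addn_r b (N2 sA' i) (N2 sB' i).
  have := normB_addn_r b (N2 sB i) (N2 sB' i).
  by rewrite !ler_norml => /andP[? ?] /andP[? ?]; apply/andP; split; lra.
- have := normB_addn_r b (N2 sA i) (N2 sB i).
  have := normB_addn_l b (N2 sB i) (N2 sB' i).
  by rewrite !ler_norml => /andP[? ?] /andP[? ?]; apply/andP; split; lra.
- have := normB_addn_r b (N2 sA i) (N2 sA' i).
  have := normB_addn_l b (N2 sA' i) (N2 sB' i).
  by rewrite !ler_norml => /andP[? ?] /andP[? ?]; apply/andP; split; lra.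
have := normB_addn_l b (N2 sA i) (N2 sA' i).
have := normB_addn_l b (N2 sA i) (N2 sB i).
by rewrite !ler_norml => /andP[? ?] /andP[? ?]; apply/andP; split; lra.
Qed.

(* Exchanges the streams A' and B and fixes A and B'. *)
Definition swap_letter (x : stream * 'I_n) : stream * 'I_n :=
  ((x.1.2, x.1.1), x.2).

(** The exchange carries the two positive terms of each summand to the two negative ones and
    conversely. *)
Lemma Zstat_deal_swap s :
  Zstat R (deal (map swap_letter s)) = - Zstat R (deal s).
Proof.
have dE g : deal (map swap_letter s) g = deal s (g.2, g.1).
  rewrite !ffunE filter_map -map_comp; congr map; apply: eq_filter => -[[a b] i] /=.
  by case: g => a' b' /=; rewrite /swap_letter/= !xpair_eqE andbC.
rewrite /Zstat -sumrN; apply: eq_bigr => i _.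
by rewrite !dE /=; ring.
Qed.

(** With equal distributions the exchange preserves the law of a letter, so the mean equals its own
    opposite. *)
Lemma wmean_Zstat_eq (D : {ffun 'I_n -> R}) N :
  wmean (fun x : stream * 'I_n => 4^-1 * stream_distr D D x.1 x.2) N
    (fun s => Zstat R (deal s)) = 0.
Proof.
set p := (X in wmean X); set h := (X in wmean _ _ X).
have := @wmean_map _ _ p N swap_letter h.
have sK : involutive swap_letter by case=> -[].
move=> /(_ sK) /=.
have pE x : p (swap_letter x) = p x.
  by rewrite /p /stream_distr !if_same.
move=> /(_ pE) /esym e.
suff : wmean p N h = - wmean p N h by lra.
rewrite {1}e -mulN1r -wmeanZ; apply: eq_wmean => s _.
by rewrite /h Zstat_deal_swap mulN1r.
Qed.

Lemma big_stream (f : stream -> R) : \sum_g f g = f sA + f sA' + f sB + f sB'.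
Proof.
transitivity (\sum_a \sum_b f (a, b)).
  by rewrite pair_bigA; apply: eq_bigr => -[].
rewrite !big_bool /=.
by rewrite /sA /sA' /sB /sB'; ring.
Qed.

(** Drop the two subtracted terms and use [|a - b| <= a + b]: every letter is then counted once.
    This gives [E Z_t <= 4 t]. *)
Lemma Zstat_le_size (ws : stream -> seq 'I_n) :
  Zstat R ws <= \sum_g (size (ws g))%:R.
Proof.
have sizeE (s : seq 'I_n) : (size s)%:R = \sum_i (count_mem i s)%:R :> R.
  rewrite -natr_sum; congr _%:R; elim: s => [|x s IH] /=; first by rewrite big1.
  rewrite big_split /= -IH (bigD1 x)//= eqxx big1 ?addn0// => i.
  by rewrite eq_sym => /negPf ->.
rewrite (eq_bigr _ (fun g _ => sizeE (ws g))) exchange_big /=.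
apply: ler_sum => i _; rewrite big_stream.
set a := (count_mem i (ws sA))%:R; set b := (count_mem i (ws sB))%:R.
set a' := (count_mem i (ws sA'))%:R; set b' := (count_mem i (ws sB'))%:R.
have := ler_normB a b; have := ler_normB a' b'.
have := normr_ge0 (a - a'); have := normr_ge0 (b - b').
by rewrite /a /b /a' /b' !normr_nat; lra.
Qed.

Lemma size_deal (s : seq (stream * 'I_n)) :
  \sum_g (size (deal s g))%:R = (size s)%:R :> R.
Proof.
elim: s => [|x s IH]; first by rewrite big1 // => g _; rewrite ffunE.
rewrite /= -natr1 -IH addrC.
have e : 1 = \sum_g (x.1 == g)%:R :> R.
  rewrite (bigD1 x.1)//= eqxx big1 ?addr0// => g.
  by rewrite eq_sym => /negPf ->.
rewrite [X in _ = X + _]e -big_split /=; apply: eq_bigr => g _; rewrite deal_cons.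
by case: eqP => _ /=; rewrite ?nat1r ?add0r.
Qed.

End Zstat.

(** * Numerical bounds *)

Section Numeric.
Variable R : realType.
Implicit Types (a b c C t x y T : R).

Lemma sin_le_id x : 0 <= x -> sin x <= x.
Proof.
rewrite le_eqVlt => /orP[/eqP <-|x0]; first by rewrite sin0.
have [|y _] := MVT x0 (fun y _ => is_derive_sin y).
  by apply: continuous_subspaceT; exact: continuous_sin.
rewrite sin0 !subr0 => ->.
by rewrite -[leRHS]mul1r; apply: ler_wpM2r; [exact: ltW|exact: cos_le1].
Qed.

(** From [cos (pi / 2) = 0] and the double angle formula, [sin^2 (pi / 4) = 1/2], which is at most
    [(pi / 4)^2]. *)
Lemma pi_sqr_ge8 : 8 <= pi ^+ 2 :> R.
Proof.
have p0 := pi_gt0 R.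
have s0 : 0 <= sin (pi / 4) :> R.
  by apply: sin_ge0_pi; apply/andP; split; lra.
have s1 : sin (pi / 4) <= pi / 4 :> R by apply: sin_le_id; lra.
have := cos_mulr2n (pi / 4 : R).
have -> : (pi / 4) *+ 2 = pi / 2 :> R by field.
rewrite cos_pihalf; have := cos2Dsin2 (pi / 4 : R).
have : sin (pi / 4) ^+ 2 <= (pi / 4) ^+ 2 :> R.
  by apply: lerXn2r => //; rewrite nnegrE; lra.
rewrite [(pi / 4) ^+ 2]expr_div_n; move: (sin _ ^+ 2) (cos _ ^+ 2) (pi ^+ 2 : R).
by move=> *; lra.
Qed.

(** Powers of [11/10 <= exp (1/10) <= 10/9] bracket the exponential at multiples of 1/10 by
    rationals, so the numerical estimates below become rational comparisons. *)
Lemma expR_tenths_le n : expR (n%:R * (1/10)) <= (10/9) ^+ n :> R.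
Proof.
rewrite expRM_natl; apply: lerXn2r; rewrite ?nnegrE ?expR_ge0//; try lra.
have := expR_ge1Dx (- (1/10 : R)); rewrite expRN => e.
have e0 := expR_gt0 (1/10 : R).
by have := ler_wpM2l (ltW e0) e; rewrite mulfV ?gt_eqF//; lra.
Qed.

Lemma expR_tenths_ge n : (11/10) ^+ n <= expR (n%:R * (1/10)) :> R.
Proof.
rewrite expRM_natl; apply: lerXn2r; rewrite ?nnegrE ?expR_ge0//; try lra.
by have := expR_ge1Dx (1/10 : R); lra.
Qed.

Lemma expR1_le3 : expR 1 <= 3 :> R.
Proof. by have := expR_tenths_le 10; rewrite mul1r mulfV// => h; apply: (le_trans h); lra. Qed.

Lemma expR1_ge : 12/5 <= expR 1 :> R.
Proof. by have := expR_tenths_ge 10; rewrite mul1r mulfV//; apply: le_trans; lra. Qed.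

Lemma ln_ge_tenths n x : (10/9) ^+ n <= x -> n%:R * (1/10) <= ln x.
Proof.
move=> h; have h' := le_trans (expR_tenths_le n) h.
rewrite -[leLHS]expRK ler_ln// posrE ?expR_gt0//.
by apply: lt_le_trans h'; exact: expR_gt0.
Qed.

Lemma log_term_ge (delta : R) : 0 < delta < 1 -> 9/10 <= log_term delta.
Proof.
move=> /andP[d0 d1].
have := @ln_ge_tenths 9 (pi ^+ 2 / (3 * delta)).
have -> : 9%:R * (1/10) = 9/10 :> R by lra.
apply; rewrite ler_pdivlMr; last lra.
have := pi_sqr_ge8; set z := pi ^+ 2; lra.
Qed.

(** The tangent to [ln] at 4 has slope 1/4 and intercept [ln 4 - 1], and [ln 4 <= 3/2]. *)
Lemma ln_le_quarter y : 0 < y -> ln y <= y / 4 + 1/2.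
Proof.
move=> y0; rewrite -[leRHS]expRK ler_ln ?posrE ?expR_gt0//.
have -> : y / 4 + 1/2 = (y / 4 - 1) + 15%:R * (1/10) by lra.
rewrite expRD.
have h1 : y / 4 <= expR (y / 4 - 1) by have := expR_ge1Dx (y / 4 - 1); lra.
have h2 : 4 <= expR (15%:R * (1/10)) :> R by apply: le_trans (expR_tenths_ge 15); lra.
by have := expR_ge0 (y / 4 - 1); nra.
Qed.

(* If [ln (ln (4 T) + 1)] exceeds [2 ln (ln a + 1)], then [T] exceeds
   [exp (ln a ^ 2 + 2 ln a) / 4], which dominates [a + b ln (ln (4 T) + 1)]. *)
Lemma loglog_inversion a b T : 36/5 <= a -> 0 <= b <= 20/3 * a ->
  a + 2 * b * ln (ln a + 1) <= T -> a + b * ln (ln (4 * T) + 1) <= T.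
Proof.
move=> a7 /andP[b0 ba] aT.
have a0 : 0 < a by lra.
have p18 : 9/5 <= ln a.
  have -> : 9/5 = 18%:R * (1/10) :> R by lra.
  by apply: ln_ge_tenths; apply: le_trans a7; lra.
have z0 : 0 <= ln (ln a + 1) by apply: ln_ge0; lra.
have aT' : a <= T by apply: le_trans aT; have := mulr_ge0 b0 z0; lra.
have T0 : 0 < 4 * T by lra.
set q := ln (4 * T); set p := ln a in p18 z0 aT *.
have eq : expR q = 4 * T by rewrite lnK.
have ep : expR p = a by rewrite lnK.
have pq : p <= q by rewrite ler_ln ?posrE//; lra.
have [h|h] := leP (ln (q + 1)) (2 * ln (p + 1)).
  by apply: le_trans aT; rewrite lerD2l; have := ler_wpM2l b0 h; lra.
have {h} qp : p ^+ 2 + 2 * p <= q.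
  have : (p + 1) ^+ 2 < q + 1.
    rewrite -ltr_ln ?posrE ?exprn_gt0//; try lra.
    by rewrite lnXn; [rewrite -mulr_natl|lra].
  by rewrite sqrrD1 mulr2n; lra.
(* With [p >= 9/5], the inequality [q >= p (p + 2)] gives [q >= 19/5 p] and
   [x >= p (p + 1) >= 126/25]. *)
have px : p <= 5/19 * q by nra.
pose x := q - p; have x5 : 126/25 <= x by rewrite /x; nra.
have eT : 4 * T = expR x * a by rewrite -eq -ep -expRD /x subrK.
(* Essentially the tangent at 5, with [e^5 >= (12/5)^5 >= 79]. It makes the remaining comparison
   linear in [x], settled by [x >= 126/25]. *)
have ex : 79 * (x - 4) <= expR x.
  have -> : expR x = expR (x - 5) * expR 1 ^+ 5.
    by rewrite -expRM_natl -expRD; congr expR; lra.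
  have h1 := expR_ge1Dx (x - 5).
  have h2 : 79 <= expR 1 ^+ 5 :> R.
    apply: (@le_trans _ _ ((12/5) ^+ 5)); first lra.
    apply: lerXn2r; rewrite ?nnegrE ?expR_ge0//; try lra.
    exact: expR1_ge.
  have h3 := expR_ge0 (x - 5).
  by nra.
have lq := @ln_le_quarter (q + 1) ltac:(lra).
have qx : q <= 19/14 * x by rewrite /x; lra.
have lq0 : 0 <= ln (q + 1) by apply: ln_ge0; lra.
have bl : b * ln (q + 1) <= 20/3 * a * ln (q + 1) by apply: ler_wpM2r.
have al : a * ln (q + 1) <= a * ((q + 1) / 4 + 1/2) by apply: ler_wpM2l => //; exact: ltW.
have aq : a * q <= a * (19/14 * x) by apply: ler_wpM2l => //; exact: ltW.
have ax : a * (79 * (x - 4)) <= a * expR x by apply: ler_wpM2l => //; exact: ltW.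
have ax5 : a * (126/25) <= a * x by apply: ler_wpM2l => //; exact: ltW.
lra.
Qed.

(** Here [C <= 4] keeps [k / C^2] away from 0, so that the iterated logarithm in [N_radicand] is
    bounded below. *)
Lemma ratio_ge16 C k : 0 < C <= 4 -> 1 <= k -> 1/16 <= k / C ^+ 2.
Proof.
move=> /andP[C0 C4] k1; have C2 : 0 < C ^+ 2 by rewrite exprn_gt0.
have C16 : 0 <= (4 - C) * (4 + C) by apply: mulr_ge0; lra.
by rewrite ler_pdivlMr//; lra.
Qed.

Lemma N_radicand_scaled c C delta k : 0 < C ->
  N_radicand c C delta k = k / C ^+ 2 * (128 * log_term delta +
    512 * expR 1 * ln (ln (128 * (k / C ^+ 2) * log_term delta) + 1) + 16 * c ^+ 2).
Proof.
move=> C0.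
have -> : 128 * (k / C ^+ 2) * log_term delta = 128 / C ^+ 2 * (k * log_term delta).
  by field; rewrite gt_eqF.
by rewrite /N_radicand; field; rewrite gt_eqF.
Qed.

Lemma radicand_log_ge (delta K : R) : 0 < delta < 1 -> 1/16 <= K ->
  36/5 <= 128 * K * log_term delta.
Proof. by move=> /log_term_ge L K16; nra. Qed.

Lemma radicand_loglog_ge (delta K : R) : 0 < delta < 1 -> 1/16 <= K ->
  9/10 <= ln (ln (128 * K * log_term delta) + 1).
Proof.
move=> d01 K16; have -> : 9/10 = 9%:R * (1/10) :> R by lra.
apply: ln_ge_tenths; apply: (@le_trans _ _ (18%:R * (1/10) + 1)); first lra.
rewrite lerD2r; apply: ln_ge_tenths.
by apply: le_trans (radicand_log_ge d01 K16); lra.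
Qed.

(** The iterated logarithm term alone suffices, as [512 * 12/5 * 9/10 >= 960]. The value
    [960 = 3 * 320] makes a deviation [mu / 2] in [exp (- u^2 / (80 t))] yield the exponent
    [- 3 t / N]. *)
Lemma N_radicand_ge c C delta k : 0 < C <= 4 -> 0 < delta < 1 -> 1 <= k ->
  960 * (k / C ^+ 2) <= N_radicand c C delta k.
Proof.
move=> C04 d01 k1; have K16 := ratio_ge16 C04 k1.
rewrite N_radicand_scaled ?(andP C04).1// [leLHS]mulrC; apply: ler_wpM2l; first lra.
have := radicand_loglog_ge d01 K16; set z := ln (_ + 1) => z1.
have L := log_term_ge d01; have e := expR1_ge; have := sqr_ge0 c.
by nra.
Qed.

Lemma N_radicand_ge60 c C delta k : 0 < C <= 4 -> 0 < delta < 1 -> 1 <= k ->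
  60 <= N_radicand c C delta k.
Proof.
move=> C04 d01 k1; have := N_radicand_ge c C04 d01 k1.
by have := ratio_ge16 C04 k1; lra.
Qed.

(** Treats the three regimes of the minimum at once: [mu^2 = t T C^2 / k] holds with [T] equal to
    [t], [t^3] and [t^2] for [k] equal to [1 / d^2], [n^2 / d^4] and [n / d^4]. *)
Lemma radicand_threshold c C delta k (t : nat) (T mu : R) : 0 < c ->
  0 < C <= 4 -> 0 < delta < 1 -> 1 <= k -> (1 <= t)%N -> t%:R <= T ->
  N_radicand c C delta k <= T -> 0 <= mu ->
  mu ^+ 2 = t%:R * T / (k / C ^+ 2) ->
  c * Num.sqrt t%:R + Psi delta t <= mu / 2 /\
  960 * (t%:R * T) <= mu ^+ 2 * N_radicand c C delta k.
Proof.
move=> c0 C04 hdelta k1; rewrite -(ler_nat R) => t1 tT rT mu0 muE.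
have K16 := ratio_ge16 C04 k1.
have K0 : 0 < k / C ^+ 2 by apply: lt_le_trans K16; lra.
have := N_radicand_ge c C04 hdelta k1; move: rT.
rewrite N_radicand_scaled ?(andP C04).1//.
have := radicand_log_ge hdelta K16; have := radicand_loglog_ge hdelta K16.
move: K16 muE K0.
set K := k / C ^+ 2 => K16 muE K0.
set L := log_term delta; have L9 : 9/10 <= L := log_term_ge hdelta.
set z := ln (ln (128 * K * L) + 1) => z1 a7 rT r960.
clearbody K.
have e := expR1_ge; have e3 := expR1_le3.
set E := expR 1 in rT r960 e e3 *.
have T0 : 0 < T by lra.
have muT : mu ^+ 2 * K = t%:R * T by rewrite muE divfK// gt_eqF.
split; last first.
  rewrite -muT; have := sqr_ge0 mu; nra.
have c2 := sqr_ge0 c.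
(* Inversion with [a = 128 K L] and [b = 256 E K], so that [2 b] is the coefficient in [N_radicand].
   The condition [b <= 20/3 a] reads [E <= 10/3 L], true as [E <= 3] and [L >= 9/10]. *)
have inv : 128 * K * L + 256 * E * K * ln (ln (4 * T) + 1) <= T.
  apply: loglog_inversion => //; last first.
    by rewrite -/z; have := mulr_ge0 (ltW K0) c2; lra.
  apply/andP; split; first by rewrite !mulr_ge0//; lra.
  have -> : 20/3 * (128 * K * L) = 256 * K * (10/3 * L) by field.
  have -> : 256 * E * K = 256 * K * E by ring.
  by apply: ler_wpM2l; lra.
have l1 : 0 <= ln (4 * t%:R) :> R by apply: ln_ge0; lra.
have lT : ln (ln (4 * t%:R) + 1) <= ln (ln (4 * T) + 1).
  have l2 : ln (4 * t%:R) <= ln (4 * T) by rewrite ler_ln ?posrE//; lra.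
  by rewrite ler_ln ?posrE//; lra.
have h1 : c * Num.sqrt t%:R <= mu / 4.
  have -> : c * Num.sqrt t%:R = Num.sqrt (c ^+ 2 * t%:R).
    by rewrite sqrtrM// sqrtr_sqr gtr0_norm.
  rewrite -[leRHS]ger0_norm ?divr_ge0// -sqrtr_sqr ler_wsqrtr//.
  have : 16 * c ^+ 2 * K <= T.
    apply: le_trans rT.
    have : 0 <= K * (128 * L + 512 * E * z) by rewrite mulr_ge0 ?addr_ge0 ?mulr_ge0//; lra.
    lra.
  move=> h; rewrite -(ler_pM2r K0).
  have -> : (mu / 4) ^+ 2 * K = t%:R * T / 16 by rewrite -muT; field.
  by have : t%:R * (16 * c ^+ 2 * K) <= t%:R * T by [apply: ler_wpM2l]; lra.
(* Multiplied by [64 K], the radicand of [Psi] becomes [t] times the left side of [inv] with [t] in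
   place of [T], hence is at most [t T]. *)
have h2 : Psi delta t <= mu / 4.
  rewrite /Psi -/L -/E; set Y := (X in Num.sqrt X).
  suff : Num.sqrt Y <= mu / 8 by lra.
  rewrite -[leRHS]ger0_norm ?divr_ge0// -sqrtr_sqr ler_wsqrtr//.
  rewrite -(ler_pM2r K0).
  have -> : (mu / 8) ^+ 2 * K = t%:R * T / 64 by rewrite -muT; field.
  have h3 : t%:R * (128 * K * L + 256 * E * K * ln (ln (4 * T) + 1)) <= t%:R * T.
    by apply: ler_wpM2l => //; lra.
  have h4 : t%:R * E * K * ln (ln (4 * t%:R) + 1) <= t%:R * E * K * ln (ln (4 * T) + 1).
    by apply: ler_wpM2l lT; rewrite !mulr_ge0//; lra.
  by rewrite /Y; lra.
lra.
Qed.

End Numeric.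

(** * The threshold [N_bound] in the three regimes of the mean *)

Section NBound.
Variable R : realType.

Lemma powR_inv_exprn (r : R) (m : nat) : 0 <= r -> (0 < m)%N ->
  (r `^ (1 / m%:R)) ^+ m = r.
Proof.
move=> r0 m0; rewrite -powR_mulrn ?powR_ge0// -powRrM mulrC mulrA mulr1.
by rewrite divff ?powRr1// pnatr_eq0 -lt0n.
Qed.

Lemma N_bound_ge60 (c C delta : R) n d : 0 < C <= 4 -> 0 < delta < 1 ->
  0 < d <= 1 -> 60 <= N_bound c C n delta d.
Proof.
move=> C04 d01 /andP[d0 d1]; rewrite /N_bound le_max; apply/orP; left.
apply: N_radicand_ge60 => //; rewrite ler_pdivlMr ?exprn_gt0// mul1r.
by apply: exprn_ile1 => //; exact: ltW.
Qed.

Lemma N_bound_threshold (c C delta : R) (n : nat) (d : R) (t : nat) : 0 < c ->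
  0 < C <= 4 -> 0 < delta < 1 -> (0 < n)%N -> 0 < d <= 1 ->
  N_bound c C n delta d <= t%:R ->
  let mu := mean_lower_bound c C n d t + c * Num.sqrt t%:R in
  [/\ 0 < mu <= 4 * t%:R, c * Num.sqrt t%:R + Psi delta t <= mu / 2 &
     960 * t%:R ^+ 2 <= mu ^+ 2 * N_bound c C n delta d].
Proof.
move=> c0 C04 hdelta n0 /andP[d0 d1] Nt.
have N60 : 60 <= N_bound c C n delta d by apply: N_bound_ge60 => //; rewrite d0.
have C0 : 0 < C by case/andP: C04.
have t60 : 60 <= t%:R :> R by apply: le_trans Nt.
have t1 : (1 <= t)%N by rewrite -(ler_nat R); lra.
have n1 : 1 <= n%:R :> R by rewrite ler1n.
set N := N_bound c C n delta d in N60 Nt *.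
rewrite /mean_lower_bound subrK; set m1 := t%:R * d.
set m2 := t%:R ^+ 2 * d ^+ 2 / n%:R; set m3 := _ / Num.sqrt n%:R.
set mu := C * _.
have m1_gt0 : 0 < m1 by rewrite mulr_gt0//; lra.
have m2_gt0 : 0 < m2 by rewrite divr_gt0 ?mulr_gt0 ?exprn_gt0//; lra.
have m3_gt0 : 0 < m3.
  by rewrite divr_gt0 ?mulr_gt0 ?powR_gt0 ?exprn_gt0 ?sqrtr_gt0//; lra.
have mu0 : 0 < mu by rewrite mulr_gt0// !lt_min m1_gt0 m2_gt0.
have mu4 : mu <= 4 * t%:R.
  have h : Num.min m1 (Num.min m2 m3) <= t%:R.
    rewrite ge_min; apply/orP; left; rewrite /m1 -[leRHS]mulr1.
    by apply: ler_wpM2l.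
  have : C <= 4 by case/andP: C04.
  move=> C4; apply: (@le_trans _ _ (C * t%:R)); first by apply: ler_wpM2l => //; exact: ltW.
  by apply: ler_wpM2r.
rewrite mu0 mu4.
(* [T] is the power [t^j] for which the entry of [N_bound] attached to [k] is a [j]-th root [rho].
   Then [rho <= N <= t] gives both [rho^j <= T] and [rho^j t <= T N]; the latter trades the radicand
   for [N] at the end. *)
have [T [k [k1 tT rT muE rN]]] : exists T k, [/\ 1 <= k, t%:R <= T,
    N_radicand c C delta k <= T, mu ^+ 2 = t%:R * T / (k / C ^+ 2) &
    N_radicand c C delta k * t%:R <= T * N].
  have d21 : d ^+ 2 <= 1 by apply: exprn_ile1 => //; exact: ltW.
  have d41 : d ^+ 4 <= 1 by apply: exprn_ile1 => //; exact: ltW.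
  have k1 : 1 <= 1 / d ^+ 2 by rewrite ler_pdivlMr ?exprn_gt0// mul1r.
  have k2 : 1 <= n%:R ^+ 2 / d ^+ 4.
    rewrite ler_pdivlMr ?exprn_gt0// mul1r; apply: (le_trans d41).
    exact: exprn_ege1.
  have k3 : 1 <= n%:R / d ^+ 4.
    by rewrite ler_pdivlMr ?exprn_gt0// mul1r; apply: (le_trans d41).
  have r0 k : 1 <= k -> 0 <= N_radicand c C delta k.
    by move=> k0; apply: le_trans (N_radicand_ge60 c C04 hdelta k0).
  have : [\/ mu = C * m1, mu = C * m2 | mu = C * m3].
    rewrite /mu /Num.min; case: ifP => _; first by constructor 1.
    by case: ifP => _; [constructor 2|constructor 3].
  have Ns : [/\ N_radicand c C delta (1 / d ^+ 2) <= N,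
     N_radicand c C delta (n%:R ^+ 2 / d ^+ 4) `^ (1 / 3) <= N &
     N_radicand c C delta (n%:R / d ^+ 4) `^ (1 / 2) <= N].
    by rewrite /N /N_bound; split; rewrite !le_max lexx ?orbT.
  case: Ns => N1 N2 N3; case=> ->.
  - exists t%:R, (1 / d ^+ 2); split => //; first by apply: le_trans Nt.
      by rewrite /m1; field; rewrite !gt_eqF.
    by rewrite mulrC; apply: ler_wpM2l.
  - exists (t%:R ^+ 3), (n%:R ^+ 2 / d ^+ 4).
    have := powR_inv_exprn (r0 _ k2) (isT : (0 < 3)%N).
    set rho := _ `^ _ in N2 * => rhoE.
    have rho0 : 0 <= rho by exact: powR_ge0.
    have rhot : rho <= t%:R by apply: le_trans Nt.
    split => //.
    + by apply: ler_eXnr => //; rewrite ler1n.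
    + by rewrite -rhoE; apply: lerXn2r; rewrite ?nnegrE.
    + by rewrite /m2; field; rewrite !gt_eqF//; lra.
    + rewrite -rhoE !exprSr expr0 !mul1r -!mulrA.
      apply: ler_pM; rewrite ?mulr_ge0//.
      apply: ler_pM; rewrite ?mulr_ge0//.
      by rewrite mulrC; apply: ler_wpM2l.
  exists (t%:R ^+ 2), (n%:R / d ^+ 4).
  have := powR_inv_exprn (r0 _ k3) (isT : (0 < 2)%N).
  set rho := _ `^ _ in N3 * => rhoE.
  have rho0 : 0 <= rho by exact: powR_ge0.
  have rhot : rho <= t%:R by apply: le_trans Nt.
  split => //.
  + by apply: ler_eXnr => //; rewrite ler1n.
  + by rewrite -rhoE; apply: lerXn2r; rewrite ?nnegrE.
  + rewrite /m3; set u := _ `^ _; set s := Num.sqrt _.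
    have u2 : u ^+ 2 = t%:R ^+ 3.
      by rewrite /u -powR_mulrn ?powR_ge0// -powRrM divfK// powR_mulrn.
    have s2 : s ^+ 2 = n%:R by rewrite /s sqr_sqrtr.
    have s0 : s != 0 by rewrite gt_eqF// /s sqrtr_gt0; lra.
    rewrite -s2 !exprMn exprVn u2.
    by field; rewrite s0 !gt_eqF.
  + rewrite -rhoE !exprSr expr0 !mul1r -!mulrA.
    apply: ler_pM; rewrite ?mulr_ge0//.
    by rewrite mulrC; apply: ler_pM.
have [h1 h2] := radicand_threshold c0 C04 hdelta k1 t1 tT rT (ltW mu0) muE.
split => //.
set r := N_radicand _ _ _ _ in rT rN h2.
have r60 : 60 <= r := N_radicand_ge60 c C04 hdelta k1.
have r0 : 0 < r by lra.
rewrite -(ler_pM2r r0).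
have e1 := ler_wpM2l (ler0n R t) rN.
have e2 := ler_wpM2r (le_trans (ler0n R 60) N60) h2.
by lra.
Qed.

End NBound.

(** * The law of the samples *)

Lemma preimage_countable_measurable (d : measure_display) (T : measurableType d)
    (V : countType) (Y : T -> V) :
  (forall v, measurable (Y @^-1` [set v])) -> forall B, measurable (Y @^-1` B).
Proof.
move=> mY B.
have -> : Y @^-1` B = \bigcup_(v : V) (if `[< B v >] then Y @^-1` [set v] else set0).
  apply/seteqP; split => [w Bw|w [v _]] /=.
    by exists (Y w) => //; case: asboolP.
  by case: asboolP => // Bv /= ->.
apply: countable_bigcupT_measurable => [|v]; first exact: countableP.
by case: asboolP.
Qed.

(** As [L] carries all the mass, [f \o Y] agrees almost everywhere with a finite combination of
    indicators. *)
Lemma expectation_finite_law (R : realType) (d : measure_display)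
    (T : measurableType d) (P : probability T R) (V : countType) (Y : T -> V)
    (L : seq V) (f : V -> R) : uniq L ->
  (forall v, measurable (Y @^-1` [set v])) ->
  (\sum_(v <- L) P (Y @^-1` [set v]) = 1)%E ->
  ('E_P[f \o Y] = \sum_(v <- L) (f v)%:E * P (Y @^-1` [set v]))%E.
Proof.
move=> uL mY PL.
have mYB := preimage_countable_measurable mY.
have mf (g : V -> R) : measurable_fun setT (g \o Y).
  by move=> _ A mA; rewrite setTI; exact: (mYB (g @^-1` A)).
have pY v w : \1_(Y @^-1` [set v]) w = (Y w == v)%:R :> R.
  rewrite indicE; congr (nat_of_bool _)%:R.
  by apply/idP/eqP; [rewrite inE|move=> <-; rewrite inE].
have sumE (g : V -> R) w : \sum_(v <- L) g v * \1_(Y @^-1` [set v]) w =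
    (Y w \in L)%:R * g (Y w).
  case: (boolP (Y w \in L)) => [YL|/negP YL].
    rewrite (big_rem _ YL) /= pY eqxx mulr1 mul1r big_seq big1 ?addr0// => v.
    rewrite mem_rem_uniq// inE pY eq_sym => /andP[/negPf -> _].
    by rewrite mulr0.
  rewrite mul0r big_seq big1// => v vL; rewrite pY; case: eqP => [e|_].
    by case: YL; rewrite e.
  by rewrite mulr0.
have intE (g : V -> R) : (\int[P]_w ((Y w \in L)%:R * g (Y w))%:E =
    \sum_(v <- L) (g v)%:E * P (Y @^-1` [set v]))%E.
  under eq_integral do rewrite -sumE -sumEFin.
  rewrite integral_sum//; last first.
    move=> v; under eq_fun do rewrite EFinM.
    by apply: integrableZl => //; apply: integrable_indic.
  apply: eq_bigr => v _; under eq_integral do rewrite EFinM.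
  rewrite integralZl//; last exact: integrable_indic.
  by rewrite integral_indic// setIT.
(* The case of the constant function 1 in [intE]. *)
have PYL : P (Y @^-1` [set` L]) = 1%E.
  have := intE (fun=> 1); under eq_bigr do rewrite mul1e.
  rewrite PL => <-; rewrite -[_ @^-1` _]setIT -integral_indic//.
  by apply: eq_integral => w _; rewrite mulr1 indicE mem_setE.
rewrite unlock -intE; apply: ae_eq_integral => //.
- exact/measurable_realfun.measurable_EFinP.
- by apply/measurable_realfun.measurable_EFinP; exact: (mf (fun v => (v \in L)%:R * f v)).
exists (~` (Y @^-1` [set` L])); split.
- exact: measurableC.
- by apply: (etrans (probability_setC P _)); rewrite ?PYL ?subee.
by move=> w /= h YL; apply: h => _; rewrite YL mul1r.
Qed.

Section SampledWord.
Variables (R : realType) (n : nat) (D1 D2 : {ffun 'I_n -> R}).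
Variables (d : measure_display) (T : measurableType d) (P : probability T R).
Variables (S : stream -> nat -> T -> 'I_n) (t : nat) (m : T -> {ffun stream -> nat}).
Hypotheses (hD1 : is_distr D1) (hD2 : is_distr D2).
Hypotheses (hS : sample_streams D1 D2 P S) (hm : sample_counts P S t m).

Definition sampled (w : T) : {ffun stream -> seq 'I_n} :=
  [ffun g => mkseq (fun j => S g j w) (m w g)].

Definition letter_prob (x : stream * 'I_n) : R :=
  4^-1 * stream_distr D1 D2 x.1 x.2.

Lemma letter_prob_ge0 x : 0 <= letter_prob x.
Proof.
by rewrite mulr_ge0// /stream_distr; case: ifP => _; [case: hD2|case: hD1].
Qed.

Lemma sum_letter_prob : \sum_x letter_prob x = 1.
Proof.
transitivity (\sum_(g : stream) \sum_i 4^-1 * stream_distr D1 D2 g i : R).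
  by rewrite pair_bigA.
rewrite (eq_bigr (fun=> 4^-1)) => [|g _].
  by rewrite big_stream; lra.
rewrite -mulr_sumr /stream_distr; case: ifP => _.
  by case: hD2 => _ ->; rewrite mulr1.
by case: hD1 => _ ->; rewrite mulr1.
Qed.

Let cells (ws : {ffun stream -> seq 'I_n}) : seq (stream * nat) :=
  [seq (g, j) | g <- enum {: stream}, j <- iota 0 (size (ws g))].

(** Puts the event in the form to which both independence hypotheses apply. The default [x0] is
    never read, since every index in [cells ws] is within range. *)
Let sampled_eq (x0 : 'I_n) ws : sampled @^-1` [set ws] =
  m @^-1` [set [ffun g => size (ws g)]] `&`
  \bigcap_(gj in [set` [fset x in cells ws]%fset])
    ((fun gj : stream * nat => S gj.1 gj.2) gj @^-1`
       [set nth x0 (ws gj.1) gj.2]).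
Proof.
apply/seteqP; split => w /=.
  move=> <-; split; first by apply/ffunP => g; rewrite !ffunE size_mkseq.
  move=> [g j] /=; rewrite in_fset => /allpairsPdep[g' [j' [_]]].
  by rewrite mem_iota ffunE size_mkseq /= => jm [-> ->]; rewrite ffunE nth_mkseq.
move=> [mw h]; apply/ffunP => g; rewrite ffunE mw ffunE.
rewrite -[RHS](mkseq_nth x0); apply/eq_in_map => j jm.
apply: (h (g, j)) => /=; rewrite in_fset; apply/allpairsPdep.
by exists g, j; rewrite mem_enum.
Qed.

Lemma measurable_sampled (x0 : 'I_n) ws : measurable (sampled @^-1` [set ws]).
Proof.
case: hm => hmm _ _; case: hS => hSm _ _.
rewrite (sampled_eq x0); apply: measurableI; first exact: hmm.
by apply: fin_bigcap_measurable => // gj _; exact: hSm.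
Qed.

(** Independence gives the multinomial weight of the sizes times the product of the sample
    probabilities, which [wmean_deal] identifies with the law of a dealt word of [4 t] letters. *)
Lemma sampled_law (x0 : 'I_n) ws : P (sampled @^-1` [set ws]) =
  (wmean letter_prob (4 * t) (fun s => (deal s == ws)%:R))%:E.
Proof.
case: hm => _ hmv hmi; case: hS => _ hSD hSi.
rewrite (sampled_eq x0) (hmi [set _] _ (fun gj => [set nth x0 (ws gj.1) gj.2])) hmv.
rewrite hSi (wmean_deal (fun=> 4^-1) (stream_distr D1 D2)) EFinM; congr (_ * _)%E.
rewrite (eq_bigr (fun gj => (stream_distr D1 D2 gj.1 (nth x0 (ws gj.1) gj.2))%:E));
  last by move=> gj _; exact: hSD.
rewrite prodEFin; congr EFin.
have uc : uniq (cells ws).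
  apply: allpairs_uniq_dep => [|g _|[g j] [g' j'] _ _ /= [-> ->]//].
    exact: enum_uniq.
  exact: iota_uniq.
rewrite (perm_big (cells ws)) /=; last first.
  by apply: uniq_perm; rewrite ?fset_uniq// => x; rewrite in_fset.
rewrite big_allpairs_dep big_enum /=; apply: eq_bigr => g _.
by rewrite (big_nth x0) /index_iota subn0.
Qed.

Lemma expectation_sampled (x0 : 'I_n) (f : {ffun stream -> seq 'I_n} -> R) :
  ('E_P[f \o sampled] = (wmean letter_prob (4 * t) (fun s => f (deal s)))%:E)%E.
Proof.
(* All dealings of words of length [4 t]: a finite list, of total mass 1 by [sumL] at the constant
   1. *)
pose L := undup [seq deal (tval w) | w : (4 * t).-tuple (stream * 'I_n)%type].
have dL (s : seq (stream * 'I_n)) : size s = (4 * t)%N -> deal s \in L.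
  move=> /eqP st; rewrite mem_undup; apply/mapP.
  by exists (Tuple st); rewrite ?mem_enum.
have sumL (g : {ffun stream -> seq 'I_n} -> R) :
    (\sum_(v <- L) (g v)%:E * P (sampled @^-1` [set v]) =
     (wmean letter_prob (4 * t) (fun s => g (deal s)))%:E)%E.
  rewrite (eq_bigr (fun v => (wmean letter_prob (4 * t)
      (fun s => g v * (deal s == v)%:R))%:E)); last first.
    by move=> v _; rewrite (sampled_law x0) wmeanZ.
  rewrite sumEFin -wmean_sum; congr EFin; apply: eq_wmean => s st.
  rewrite (big_rem _ (dL s st)) /= eqxx mulr1 big_seq big1 ?addr0// => v.
  by rewrite mem_rem_uniq ?undup_uniq// inE eq_sym => /andP[/negPf -> _]; rewrite mulr0.
rewrite (@expectation_finite_law _ _ _ P _ sampled L f (undup_uniq _) (measurable_sampled x0)); first exact: sumL.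
have := sumL (fun=> 1); under eq_bigr do rewrite mul1e.
by move=> ->; rewrite wmean_cst// sum_letter_prob.
Qed.

Lemma ZrvE : Zrv R S m = (fun ws : {ffun stream -> seq 'I_n} => Zstat R ws) \o sampled.
Proof.
by apply/funext => w; rewrite /Zrv /= /Zstat; apply: eq_bigr => i _; rewrite !ffunE.
Qed.

Let mZ : R := wmean letter_prob (4 * t) (fun s => Zstat R (deal s)).

Lemma expectation_Zrv (x0 : 'I_n) : ('E_P[Zrv R S m] = mZ%:E)%E.
Proof. by rewrite ZrvE (expectation_sampled x0). Qed.

Lemma expectation_Zrv_le (x0 : 'I_n) : ('E_P[Zrv R S m] <= (4 * t%:R)%:E)%E.
Proof.
rewrite (expectation_Zrv x0) lee_fin -natrM -[leRHS](wmean_cst sum_letter_prob (4 * t)).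
apply: ler_wmean => [|s st]; first exact: letter_prob_ge0.
by apply: (le_trans (Zstat_le_size _ _)); rewrite size_deal st.
Qed.

Lemma measurable_Zrv (x0 : 'I_n) (B : set R) : measurable (Zrv R S m @^-1` B).
Proof.
rewrite ZrvE; exact: (preimage_countable_measurable (measurable_sampled x0)
  ((fun ws : {ffun stream -> seq 'I_n} => Zstat R ws) @^-1` B)).
Qed.

(** The word tail bound with [b = 2] and [N = 4 t], for which [5 b^2 N = 80 t] and
    [b N / 4 = 2 t]. *)
Lemma Zrv_tail (x0 : 'I_n) (u : R) : (1 <= t)%N -> 0 <= u <= 2 * t%:R ->
  (P [set w | (u <= `|Zrv R S m w - mZ|)%R] <=
   (2 * expR (- (u ^+ 2 / (80 * t%:R))))%:E)%E.
Proof.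
move=> t1 /andP[u0 u2].
have mA := measurable_Zrv x0 [set z | u <= `|z - mZ|].
rewrite -[X in P X]setIT -integral_indic//.
have -> : (\int[P]_w (\1_[set w | (u <= `|Zrv R S m w - mZ|)%R] w)%:E =
  'E_P[(fun ws : {ffun stream -> seq 'I_n} => (u <= `|Zstat R ws - mZ|)%R%:R) \o sampled])%E.
  rewrite unlock; apply: eq_integral => w _.
  by rewrite ZrvE indicE mem_setE.
rewrite (expectation_sampled x0) lee_fin.
have := @wmean_tail _ _ letter_prob letter_prob_ge0 sum_letter_prob 2 u (4 * t)
  (fun s => Zstat R (deal s)).
move=> /(_ (@Zstat_deal_insert R n)) h.
apply: (le_trans (h _ _ _ _)); rewrite ?muln_gt0//.
  by rewrite natrM; lra.
by rewrite ler_pM2l// ler_expR natrM le_eqVlt; apply/orP; left; apply/eqP; field;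
  rewrite pnatr_eq0 -lt0n.
Qed.

End SampledWord.

(** * Stopping times *)

(** A nonnegative integral is a supremum over the simple functions below the integrand, hence
    monotone for arbitrary functions; this applies directly to stopping times. *)
Lemma ge0_le_integralT (R : realType) (d : measure_display)
    (T : measurableType d) (mu : {measure set T -> \bar R}) (f g : T -> \bar R) :
  (forall x, (0 <= f x)%E) -> (forall x, (f x <= g x)%E) ->
  (\int[mu]_x f x <= \int[mu]_x g x)%E.
Proof.
move=> f0 fg; have g0 x : (0 <= g x)%E by apply: le_trans (fg x).
rewrite !ge0_integralTE//; apply: le_ereal_sup => _ [h hf <-].
by exists h => // x; apply: le_trans (fg x).
Qed.

Lemma nneseries_le (R : realType) (u : nat -> \bar R) (b : \bar R) :
  (forall n, (0 <= u n)%E) -> (forall n, (\sum_(i < n) u i <= b)%E) ->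
  (\sum_(i <oo) u i <= b)%E.
Proof.
move=> u0 ub; apply: lime_le; first by apply: is_cvg_nneseries => n _ _.
by apply: nearW => n; rewrite big_mkord.
Qed.

Section FirstTime.
Variables (R : realType).

Lemma first_time_ge0 (E : nat -> Prop) : (0 <= first_time R E)%E.
Proof. by apply: le_ereal_inf_tmp => _ [t _ <-]; rewrite lee_fin. Qed.

(** If [k] is the first stop at or after [m], the terms of index below [k] all equal 1; ignoring
    stops before [m] can only delay. Without such a [k] the series diverges. *)
Lemma first_time_le_series (E : nat -> Prop) (m : nat) : (1 <= m)%N ->
  (first_time R E <= \sum_(t <oo) (if (t < m)%N || ~~ `[< E t >] then 1 else 0))%E.
Proof.
move=> m1.
pose u t : \bar R := if (t < m)%N || ~~ `[< E t >] then 1%E else 0%E.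
rewrite -[leRHS]/(\sum_(t <oo) u t)%E.
have u0 t : (0 <= u t)%E by rewrite /u; case: ifP.
have uk k : (forall t, (m <= t < k)%N -> ~ E t) ->
    ((k%:R)%:E <= \sum_(t <oo) u t)%E.
  move=> h; apply: le_trans (nneseries_lim_ge k _); last by move=> t _ _; exact: u0.
  rewrite big_mkord (eq_bigr (fun=> 1%E)) => [|[t tk] _ /=].
    by rewrite sumEFin big_const_ord iter_addr_0.
  rewrite /u; case: ltnP => //= mt; case: asboolP => // /h; by rewrite mt.
have [[t /andP[mt /asboolP Et]]|nE] :=
  pselect (exists t, (m <= t)%N && `[< E t >]).
  have ex : exists t, (m <= t)%N && `[< E t >] by exists t; rewrite mt; apply/asboolP.
  case: (ex_minnP ex) => k /andP[mk /asboolP Ek] kmin.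
  apply: (@le_trans _ _ (k%:R)%:E).
    by apply: ereal_inf_lbound; exists k => //; split=> //; exact: leq_trans mk.
  apply: uk => s /andP[ms sk] Es.
  by have := kmin s; rewrite ms (asboolT Es) => /(_ isT); rewrite leqNgt sk.
have -> : (\sum_(t <oo) u t = +oo)%E; last exact: leey.
apply: eq_infty => r; apply: (@le_trans _ _ ((Num.truncn `|r|).+1%:R)%:E).
  rewrite lee_fin (le_trans (ler_norm r))// ltW//.
  by case/andP: (truncn_itv (normr_ge0 r)).
apply: uk => t /andP[mt _] Et; apply: nE.
by exists t; rewrite mt; apply/asboolP.
Qed.

(** With [q = exp (- 3 / N)], [N <= m] gives [q^m <= exp (- 3) <= 1/12], and
    [exp (3 / N) >= 1 + 3 / N] gives [1 - q >= 3 / (N + 3)]. *)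
Lemma geometric_partial_sum_le (N : R) (m M : nat) : 60 <= N -> N <= m%:R ->
  \sum_(t < M) (if (t < m)%N then 1 else 2 * expR (- (3 * t%:R / N))) <=
  m%:R + (N + 3) / 12.
Proof.
move=> N60 Nm; set q := expR (- (3 / N)).
have N0 : 0 < N by lra.
have q0 : 0 < q by exact: expR_gt0.
have qE t : expR (- (3 * t%:R / N)) = q ^+ t.
  by rewrite /q -expRM_natr; congr expR; ring.
have q1 : q * (N + 3) <= N.
  rewrite /q expRN mulrC ler_pdivrMr ?expR_gt0//.
  have := ler_wpM2l (ltW N0) (expR_ge1Dx (3 / N)).
  by rewrite mulrDr mulr1 mulrC divfK ?gt_eqF//; lra.
have qm : q ^+ m <= 1/12.
  rewrite -qE; apply: (@le_trans _ _ (expR (- 3))).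
    by rewrite ler_expR lerN2 ler_pdivlMr//; lra.
  have -> : - 3 = - (3%:R * 1) :> R by rewrite mulr1.
  rewrite expRN -div1r ler_pdivrMr ?expR_gt0// expRM_natl.
  have : (12/5) ^+ 3 <= expR 1 ^+ 3 :> R.
    by apply: lerXn2r; rewrite ?nnegrE ?expR_ge0 ?expR1_ge//; lra.
  lra.
have q_lt1 : q < 1 by rewrite -(ltr_pM2r N0); lra.
suff : \sum_(t < M) (if (t < m)%N then 1 else 2 * expR (- (3 * t%:R / N))) <=
    m%:R + 2 * (q ^+ m / (1 - q)).
  move=> h; apply: (le_trans h); rewrite lerD2l.
  have -> : 2 * (q ^+ m / (1 - q)) = 2 * q ^+ m / (1 - q) by ring.
  rewrite ler_pdivrMr; last by rewrite subr_gt0.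
  by apply: (@le_trans _ _ (1/6)); [lra|nra].
have geo k : \sum_(t < k) 2 * q ^+ (m + t) <= 2 * (q ^+ m / (1 - q)).
  rewrite -mulr_sumr; apply: ler_wpM2l => //.
  under eq_bigr do rewrite exprD.
  rewrite -mulr_sumr; apply: ler_wpM2l; first by rewrite exprn_ge0// ltW.
  rewrite -[leRHS]div1r ler_pdivlMr ?subr_gt0//.
  have := subrX1 q k; set s := \sum_(i < k) _ => e.
  have : 0 <= q ^+ k by rewrite exprn_ge0// ltW.
  lra.
have [Mm|mM] := leqP M m.
  rewrite (eq_bigr (fun=> 1)) => [|[t tM] _ /=]; last by rewrite (leq_trans tM).
  rewrite sumr_const card_ord; apply: ler_wpDr; last by rewrite ler_nat.
  by rewrite mulr_ge0// divr_ge0 ?exprn_ge0 ?subr_ge0// ltW.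
rewrite -(subnKC (ltnW mM)) big_split_ord /=; apply: lerD.
  rewrite (eq_bigr (fun=> 1)) => [|[t tm] _ /=]; last by rewrite tm.
  by rewrite sumr_const card_ord.
rewrite (eq_bigr (fun t : 'I_(M - m) => 2 * q ^+ (m + t))) => [|t _]; first exact: geo.
by rewrite ltnNge leq_addr /= qE.
Qed.

(** Integrate the counting series term by term, bounding the terms below [m] by 1. Since
    [m <= N + 1], the total is at most [N + 1 + (N + 3) / 12], below [2 N] for [N >= 60]. *)
Lemma integral_first_time_le (d : measure_display) (T : measurableType d)
    (P : probability T R) (E : nat -> T -> Prop) (N : R) : 60 <= N ->
  (forall t, (1 <= t)%N -> measurable [set w | E t w]) ->
  (forall t, (1 <= t)%N -> N <= t%:R ->
     (P (~` [set w | E t w]) <= (2 * expR (- (3 * t%:R / N)))%:E)%E) ->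
  (\int[P]_w first_time R (fun t => E t w) <= (2 * N)%:E)%E.
Proof.
move=> N60 mE PE; pose m := (Num.truncn N).+1.
have /andP[mN Nm] : m.-1%:R <= N < m%:R by apply: truncn_itv; lra.
pose A t : set T := if (t < m)%N then setT else ~` [set w | E t w].
have mA t : measurable (A t).
  by rewrite /A; case: ltnP => // mt; apply: measurableC; apply: mE; exact: leq_trans mt.
apply: (@le_trans _ _ (\int[P]_w \sum_(t <oo) (\1_(A t) w)%:E)%E).
  apply: ge0_le_integralT => w; first exact: first_time_ge0.
  apply: (le_trans (first_time_le_series _ (isT : (1 <= m)%N))).
  rewrite le_eqVlt; apply/orP; left; apply/eqP; apply: eq_eseriesr => t _.
  rewrite /A; case: ltnP => /= _; first by rewrite indicT.
  rewrite indicE; case: asboolP => h /=.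
    by rewrite memNset//; exact: (fun x => x h).
  by rewrite mem_set.
rewrite integral_nneseries//; last first.
  by move=> t; apply/measurable_realfun.measurable_EFinP; exact: measurable_realfun.measurable_indic.
apply: nneseries_le => [t|M]; first by apply: integral_ge0 => w _; rewrite lee_fin.
apply: (@le_trans _ _ (\sum_(t < M)
   (if (t < m)%N then 1 else 2 * expR (- (3 * t%:R / N))))%:E).
  rewrite -sumEFin; apply: lee_sum => t _.
  rewrite integral_indic// setIT /A; case: ltnP => mt; first exact: probability_le1.
  apply: PE; first exact: leq_trans mt.
  by apply: (le_trans (ltW Nm)); rewrite ler_nat.
rewrite lee_fin; apply: (le_trans (geometric_partial_sum_le M N60 (ltW Nm))).
rewrite /m -natr1 in mN *; lra.
Qed.

End FirstTime.

(** * Deterministic samples and the bound [C <= 4] *)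

Section ConstantSamples.
Variables (R : realType) (d : measure_display) (T : measurableType d)
  (P : probability T R).

Lemma preimage_const (V : Type) (v : V) (A : set V) :
  (fun _ : T => v) @^-1` A = if `[< A v >] then setT else set0.
Proof. by apply/seteqP; split => w /=; case: asboolP. Qed.

Lemma bigcap_const (I : choiceType) (V : Type) (v : I -> V) (J : {fset I})
    (E : I -> set V) :
  \bigcap_(i in [set` J]) ((fun _ : T => v i) @^-1` E i) =
  if `[< forall i, i \in J -> E i (v i) >] then setT else set0.
Proof.
by case: asboolP => h; apply/seteqP; split => w //=.
Qed.

Lemma const_mutually_independent (I : choiceType) (V : Type) (v : I -> V) :
  mutually_independent P (fun i (_ : T) => v i).
Proof.
move=> J E; rewrite bigcap_const.
under eq_bigr do rewrite preimage_const.
case: asboolP => h.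
  rewrite probability_setT big_seq big1// => i iJ.
  by case: asboolP => [_|]; [rewrite probability_setT|have := h i iJ].
have [i iJ nE] : exists2 i, i \in J & ~ E i (v i).
  by apply: contrapT => h'; apply: h => i iJ; apply: contrapT => ?; apply: h'; exists i.
rewrite measure0 (big_rem _ iJ) /=; case: asboolP => // _.
by rewrite measure0 mul0e.
Qed.

Lemma const_independent_of_family (I : choiceType) (V W : Type) (Y : T -> W)
    (v : I -> V) : independent_of_family P Y (fun i (_ : T) => v i).
Proof.
move=> F J E; rewrite bigcap_const; case: asboolP => _.
  by rewrite setIT probability_setT mule1.
by rewrite setI0 measure0 mule0.
Qed.

End ConstantSamples.

Definition point_mass (R : realType) (n : nat) (i0 : 'I_n) : {ffun 'I_n -> R} :=
  [ffun i => (i0 == i)%:R].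

Lemma is_distr_point_mass (R : realType) n (i0 : 'I_n) : is_distr (point_mass R i0).
Proof.
split=> [i|]; first by rewrite ffunE.
rewrite (bigD1 i0)//= ffunE eqxx big1 ?addr0// => i.
by rewrite ffunE eq_sym => /negPf ->.
Qed.

Lemma TV_point_mass (R : realType) n (i0 i1 : 'I_n) : i0 != i1 ->
  TV (point_mass R i0) (point_mass R i1) = 1.
Proof.
move=> i01; rewrite /TV (bigD1 i0)//= (bigD1 i1) 1?eq_sym//= !ffunE !eqxx.
rewrite (negPf i01) eq_sym (negPf i01) subr0 sub0r normrN !normr1 big1 ?addr0; last first.
  by move=> i /andP[n0 n1]; rewrite !ffunE !(eq_sym _ i) (negPf n0) (negPf n1) subrr normr0.
lra.
Qed.

Lemma TV_le1 (R : realType) n (D D' : {ffun 'I_n -> R}) :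
  is_distr D -> is_distr D' -> TV D D' <= 1.
Proof.
move=> [D0 D1] [D'0 D'1]; rewrite /TV.
suff : \sum_(i < n) `|D i - D' i| <= 2 by lra.
have -> : 2 = \sum_(i < n) (D i + D' i) by rewrite big_split /= D1 D'1.
apply: ler_sum => i _; apply: (le_trans (ler_normB _ _)).
by rewrite !ger0_norm.
Qed.

Lemma sample_streams_point_mass (R : realType) n (i0 i1 : 'I_n)
    (d : measure_display) (T : measurableType d) (P : probability T R) :
  sample_streams (point_mass R i0) (point_mass R i1) P
    (fun g _ _ => if g.1 then i1 else i0).
Proof.
split=> [g j i|g j i|].
- by rewrite preimage_const; case: asboolP.
- rewrite preimage_const /stream_distr.
  by case: g.1; rewrite ffunE; case: asboolP => /= [->|/eqP/negPf ->];
    rewrite ?eqxx ?probability_setT ?measure0.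
exact: (const_mutually_independent P (fun gj : stream * nat => if gj.1.1 then i1 else i0)).
Qed.

(** At distance 1 and for [t >= n], both [t^2 / n] and [t^(3/2) / sqrt n] are at least [t], so the
    minimum is the linear term. *)
Lemma mean_lower_bound1_ge (R : realType) (c C : R) n t : 0 < C -> (0 < n <= t)%N ->
  C * t%:R - c * Num.sqrt t%:R <= mean_lower_bound c C n 1 t.
Proof.
move=> C0 /andP[n0 nt]; rewrite /mean_lower_bound lerD2r ler_pM2l//.
rewrite mulr1 !expr1n !mulr1 !le_min lexx /=.
have n0' : 0 < n%:R :> R by rewrite ltr0n.
have nt' : n%:R <= t%:R :> R by rewrite ler_nat.
have t0 : 0 < t%:R :> R by exact: lt_le_trans nt'.
apply/andP; split; first by rewrite ler_pdivlMr// expr2 ler_pM2l.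
rewrite ler_pdivlMr ?sqrtr_gt0//.
have -> : t%:R `^ (3 / 2) = t%:R * Num.sqrt t%:R :> R.
  have -> : 3 / 2 = 1 + 2^-1 :> R by lra.
  by rewrite powRD ?gt_eqF ?implybT// powRr1 ?powR12_sqrt ?ltW.
by rewrite ler_pM2l// ler_wsqrtr.
Qed.

(* Deterministic samples from two distinct point masses have total variation 1
   and [Z_t <= 4 t], so a lower bound linear in [t] has slope at most 4. *)
Lemma mean_constant_le4 (R : realType) (n : nat) (eps c C : R) (d : measure_display)
    (T : measurableType d) (P : probability T R)
    (m : nat -> T -> {ffun stream -> nat}) (S : stream -> nat -> T -> 'I_n) :
  (2 <= n)%N -> eps < 1 -> 0 < c -> 0 < C ->
  (forall D1 D2 : {ffun 'I_n -> R},
     is_distr D1 -> is_distr D2 -> eps < TV D1 D2 ->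
     forall k : nat, (1 <= k)%N ->
     forall S m, sample_streams D1 D2 P S -> sample_counts P S k m ->
     ((mean_lower_bound c C n (TV D1 D2) k)%:E <= 'E_P[Zrv R S m])%E) ->
  (forall t : nat, (1 <= t)%N -> sample_counts P S t (m t)) -> C <= 4.
Proof.
move=> n2 eps1 c0 C0 hmean hm; rewrite leNgt; apply/negP => C4.
pose i0 : 'I_n := Ordinal (ltnW n2); pose i1 : 'I_n := Ordinal n2.
have i01 : i0 != i1 by [].
have dist := is_distr_point_mass R.
(* Large enough for [n <= t] and for [c^2 < (C - 4)^2 t], which contradicts
   [(C - 4) sqrt t <= c]. *)
pose t := (n + (Num.truncn (c ^+ 2 / (C - 4) ^+ 2)).+1)%N.
have t1 : (1 <= t)%N by rewrite /t addnS.
have bound : C * t%:R - c * Num.sqrt t%:R <= 4 * t%:R.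
  apply: (@le_trans _ _ (mean_lower_bound c C n 1 t)).
    by apply: mean_lower_bound1_ge => //; rewrite (ltnW n2) leq_addr.
  rewrite -lee_fin.
  pose S' (g : stream) (_ : nat) (_ : T) := if g.1 then i1 else i0.
  have hS' : sample_streams (point_mass R i0) (point_mass R i1) P S'.
    exact: sample_streams_point_mass.
  (* The given counts keep their law, and constant samples are independent of anything. *)
  have hm' : sample_counts P S' t (m t).
    case: (hm t t1) => h1 h2 _; split => //.
    exact: (const_independent_of_family P (m t) (fun gj : stream * nat => if gj.1.1 then i1 else i0)).
  have TV1 := TV_point_mass R i01.
  have := hmean _ _ (dist _ _) (dist _ _) _ t t1 S' (m t) hS' hm'.
  rewrite TV1 => /(_ eps1) /le_trans; apply.
  exact: (expectation_Zrv_le (dist _ _) (dist _ _) hS' hm' i0).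
have s2 : Num.sqrt t%:R ^+ 2 = t%:R :> R by rewrite sqr_sqrtr.
have s0 : 0 < Num.sqrt t%:R :> R by rewrite sqrtr_gt0 ltr0n.
have : c ^+ 2 < (C - 4) ^+ 2 * t%:R.
  rewrite mulrC -ltr_pdivrMr ?exprn_gt0 ?subr_gt0//.
  have q0 : 0 <= c ^+ 2 / (C - 4) ^+ 2 by rewrite divr_ge0 ?sqr_ge0.
  have /andP[_ h] := truncn_itv q0.
  by apply: (lt_le_trans h); rewrite ler_nat /t leq_addl.
rewrite ltNge => /negP; apply.
rewrite -[in leLHS]s2 -exprMn; apply: lerXn2r; rewrite ?nnegrE; try lra.
  by rewrite mulr_ge0//; lra.
rewrite -(ler_pM2r s0) -mulrA -expr2 s2; lra.
Qed.

(** * Expected stopping times under equality and under separation *)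

Theorem theorem7 (R : realType) (n : nat) (eps delta c C : R)
  (hn : (2 <= n)%N)
  (heps : 0 < eps < 1) (hdelta : 0 < delta < 1) (hc : 0 < c) (hC : 0 < C)
  (hmean : forall D1 D2 : {ffun 'I_n -> R},
     is_distr D1 -> is_distr D2 -> eps < TV D1 D2 ->
     forall k : nat, (1 <= k)%N ->
     forall (d : measure_display) (T : measurableType d) (P : probability T R)
       (S : stream -> nat -> T -> 'I_n) (m : T -> {ffun stream -> nat}),
     sample_streams D1 D2 P S -> sample_counts P S k m ->
     ((mean_lower_bound c C n (TV D1 D2) k)%:E <= 'E_P[Zrv R S m])%E)
  (D1 D2 : {ffun 'I_n -> R}) (hD1 : is_distr D1) (hD2 : is_distr D2)
  (d : measure_display) (T : measurableType d) (P : probability T R)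
  (S : stream -> nat -> T -> 'I_n) (m : nat -> T -> {ffun stream -> nat})
  (hS : sample_streams D1 D2 P S)
  (hm : forall t : nat, (1 <= t)%N -> sample_counts P S t (m t)) :
  let Z := fun t : nat => Zrv R S (m t) in
  (D1 = D2 ->
     (\int[P]_w tau1 c C n eps delta Z w <= (2 * N_bound c C n delta eps)%:E)%E)
  /\
  (eps < TV D1 D2 ->
     (\int[P]_w tau2 delta Z w <= (2 * N_bound c C n delta (TV D1 D2))%:E)%E).
Proof.
move=> Z; pose x0 : 'I_n := Ordinal (ltnW hn).
have /andP[e0 e1] := heps.
have C04 : 0 < C <= 4.
  rewrite hC /=; apply: (mean_constant_le4 hn e1 hc hC _ hm) => D D' hD hD' eTV k k1 S' m'.
  exact: hmean.
have n0 : (0 < n)%N := ltnW hn.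
pose mZ t := wmean (letter_prob D1 D2) (4 * t) (fun s => Zstat R (deal s)).
have mF t (B : set R) : (1 <= t)%N -> measurable (Z t @^-1` B).
  by move=> t1; exact: (measurable_Zrv hS (hm t t1) x0).
(* [A] stands for the values of [Z_t] at which the test does not stop. In both cases they are at
   distance at least [Delta_t - Psi_t], hence [mu / 2], from the mean. *)
have fail (eta : R) (A : set R) t : 0 < eta <= 1 -> (1 <= t)%N ->
    N_bound c C n delta eta <= t%:R ->
    (forall z, A z -> mean_lower_bound c C n eta t - Psi delta t <= `|z - mZ t|) ->
    (P (Z t @^-1` A) <= (2 * expR (- (3 * t%:R / N_bound c C n delta eta)))%:E)%E.
  move=> eta01 t1 Nt hA.
  have [] := N_bound_threshold hc C04 hdelta n0 eta01 Nt.
  set mu := _ + _; set N := N_bound _ _ _ _ _ => /andP[mu0 mu4] mu2 muN.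
  have N60 : 60 <= N by exact: N_bound_ge60.
  have t0 : 0 < t%:R :> R by rewrite ltr0n.
  have u : 0 <= mu / 2 <= 2 * t%:R by apply/andP; split; lra.
  apply: (le_trans _ (le_trans (Zrv_tail hD1 hD2 hS (hm t t1) x0 t1 u) _)).
    apply: le_measure; rewrite ?inE.
    + exact: mF.
    + exact: (mF t [set z | mu / 2 <= `|z - mZ t|]).
    by move=> w /= /hA; apply: le_trans; rewrite /mu in mu2 *; lra.
  rewrite lee_fin ler_pM2l// ler_expR lerN2.
  have N0 : 0 < N by lra.
  rewrite ler_pdivrMr// mulrAC ler_pdivlMr ?mulr_gt0//.
  by lra.
split => [D12|eD].
- have -> : tau1 c C n eps delta Z = fun w => first_time R (fun t =>
      `|Z t w| <= mean_lower_bound c C n eps t - Psi delta t) by [].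
  have e01 : 0 < eps <= 1 by rewrite e0 ltW.
  apply: integral_first_time_le; first exact: N_bound_ge60.
    by move=> t t1; exact: (mF t [set z | `|z| <= _]).
  move=> t t1 Nt.
  apply: (fail eps (~` [set z | `|z| <= mean_lower_bound c C n eps t - Psi delta t])) => // z /=.
  (* The mean is 0, so the failed test [|Z_t| > Delta_t - Psi_t] is itself the deviation. *)
  have -> : mZ t = 0 by rewrite /mZ /letter_prob D12; exact: wmean_Zstat_eq.
  by rewrite subr0 => /negP; rewrite -ltNge => /ltW.
have d01 : 0 < TV D1 D2 <= 1 by rewrite (lt_trans e0 eD) TV_le1.
have -> : tau2 delta Z = fun w => first_time R (fun t => Psi delta t < `|Z t w|) by [].
apply: integral_first_time_le; first exact: N_bound_ge60.
  by move=> t t1; exact: (mF t [set z | Psi delta t < `|z|]).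
move=> t t1 Nt.
apply: (fail (TV D1 D2) (~` [set z | Psi delta t < `|z|])) => // z /= /negP.
rewrite -leNgt => zPsi.
(* The mean is at least the lower bound at [TV D1 D2], while [z <= Psi]; their difference is the
   required deviation. *)
have := hmean D1 D2 hD1 hD2 eD t t1 d T P S (m t) hS (hm t t1).
rewrite (expectation_Zrv hD1 hD2 hS (hm t t1) x0) lee_fin -/(mZ t) => mu.
have := ler_norm z; have := ler_norm (mZ t - z); rewrite distrC.
lra.
Qed.
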